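(* Let $n\ge1$ and $f,g\in \mathrm{Euc}(n)\cong\mathbf I(\mathbb E^n)$. Then $\sigma_f=\sigma_g$ if and only if the centralizers $\mathrm{Euc}(n)_f=\{h:hf=fh\}$ and $\mathrm{Euc}(n)_g$ are conjugate subgroups of $\mathrm{Euc}(n)$ (i.e. $f,g$ have the same orbit type under conjugation).
   Context: $\mathrm{Euc}(n)$ is the group of matrices $\begin{pmatrix}A&a\\0&1\end{pmatrix}$, $A\in O(n)$, $a\in\mathbb R^n$, acting on $\mathbb E^n=\{x\in\mathbb R^{n+1}:x_{n+1}=1\}$; for such $f$ put $\varphi=f$ (as a linear map of $\mathbb R^{n+1}$) and $\varphi_0=A$. Let $d=\dim\ker(\varphi-I)$ and $r=\dim\ker(A-I)$; then either $d=r+1$ ($f$ has a fixed point: type $e$, elliptic) or $d=r$ (type $h$, hyperbolic). Let $\varphi_R$ be the restriction of $A$ to the orthogonal complement of $\ker(A-I)$ in $\mathbb R^n$ (an orthogonal map with no eigenvalue $1$). The Segre symbol is $\sigma_f=[t;r;\tilde\sigma_{\varphi_R}]$ with $t\in\{e,h\}$, where for an orthogonal map $B$ the symbol $\tilde\sigma_B$ consists of the multiset of $\dim_{\mathbb C}\ker(B-\lambda)$ over the distinct conjugate pairs $\{\lambda,\bar\lambda\}$ of non-real eigenvalues, together with the multiset of $\dim\ker(B-\varepsilon)$ over the eigenvalues $\varepsilon\in\{\pm1\}$ of $B$. *)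

(* Defs.v *)
From HB Require Import structures.
From mathcomp Require Import all_boot all_order all_algebra.
From Stdlib Require Import ClassicalEpsilon.
Set Implicit Arguments. Unset Strict Implicit. Unset Printing Implicit Defensive.
Import Order.TTheory GRing.Theory Num.Theory.
Local Open Scope ring_scope.

Section Euc.
Variable C : numClosedFieldType.

Definition real_mx m p (M : 'M[C]_(m, p)) : Prop := forall i j, M i j \is Num.real.

Definition orthogonal_mx n (A : 'M[C]_n) : Prop := real_mx A /\ A *m A^T = 1%:M.

Definition isEuc n (M : 'M[C]_(n + 1)) : Prop :=
  exists (A : 'M[C]_n) (a : 'cV[C]_n),
    orthogonal_mx A /\ real_mx a /\ M = block_mx A a 0 (1%:M : 'M[C]_1).

Definition lin_part n (M : 'M[C]_(n + 1)) : 'M[C]_n := ulsubmx M.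

(* dim ker (B - l), kernel taken on column vectors (B x = l x) *)
Definition dimker n (B : 'M[C]_n) (l : C) : nat := \rank (eigenspace B^T l).

(* dim_C ker(phi_R - l) where phi_R is the restriction of A to the
   orthogonal complement W of ker(A - I); W is represented (complexified)
   as the row space of vectors orthogonal to ker(A - I). *)
Definition phiR_dim n (A : 'M[C]_n) (l : C) : nat :=
  \rank (kermx (eigenspace A^T 1)^T :&: eigenspace A^T l)%MS.

(* a duplicate-free list of representatives (Im l > 0) of the distinct
   conjugate pairs of non-real eigenvalues of phi_R *)
Definition cpairs n (A : 'M[C]_n) : seq C :=
  epsilon (inhabits [::])
    (fun s => uniq s /\ forall l, (l \in s) = (0 < 'Im l) && (0 < phiR_dim A l)%N).

Inductive segre_type := Elliptic | Hyperbolic.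

(* Segre symbol [t; r; complex multiset; real (+-1) multiset];
   multisets represented as sorted lists. *)
Definition segre n (M : 'M[C]_(n + 1)) : segre_type * nat * seq nat * seq nat :=
  let A := lin_part M in
  let d := dimker M 1 in
  let r := dimker A 1 in
  ((if d == r.+1 then Elliptic else Hyperbolic),
   r,
   sort leq [seq phiR_dim A l | l <- cpairs A],
   sort leq [seq phiR_dim A e | e <- [:: 1; -1] & (0 < phiR_dim A e)%N]).

Definition centralizer n (f : 'M[C]_(n + 1)) (h : 'M[C]_(n + 1)) : Prop :=
  isEuc h /\ h *m f = f *m h.

Definition conj_centralizers n (f g : 'M[C]_(n + 1)) : Prop :=
  exists k, isEuc k /\
    forall h, centralizer f h <-> centralizer g (invmx k *m h *m k).

End Euc.

(* Main.v *)
Require Import Defs.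
From HB Require Import structures.
From mathcomp Require Import all_boot all_order all_fingroup all_algebra.
From mathcomp Require Import zify ring.
From Stdlib Require Import ClassicalEpsilon.
Set Implicit Arguments.
Unset Strict Implicit.
Unset Printing Implicit Defensive.
Import Order.TTheory GRing.Theory Num.Theory Num.Def.
Local Open Scope ring_scope.
Local Open Scope sesquilinear_scope.

(** Both the Segre symbol and the conjugacy class of the centralizer record how
    R^n splits into eigenspaces of the linear part A, up to renaming the
    eigenvalues.

    If the symbols agree, renaming the eigenvalues of A as those of B gives a real
    orthogonal A' with the same commutant and the same fixed vectors as A and
    with the spectrum of B.  Normal matrices with the same spectrum are unitarily
    similar, real similar matrices are similar over the reals, and polar
    decomposition turns a real similarity S of A' and B into the orthogonal one
    S (S^T S)^(-1/2).  The translation parts are moved into the fixed spaces and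
    aligned there by a reflection.

    Conversely, translations in the centralizer recover the fixed space, and -1 is
    the linear part of an element of the centralizer exactly when there is a
    fixed point.  For an eigenvector v of A, the centralizer contains an element
    whose linear part multiplies v by i and its conjugate by -i (or reflects v, if v
    is real) and is the identity on the orthogonal complement.  Any B with the
    same centralizer commutes with these maps, so A and B have the same
    eigenspaces. *)

(** * Real and orthogonal matrices, kernel dimensions and ranks *)

Section LinearAlgebra.
Variable C : numClosedFieldType.

Lemma real_mxP m p (M : 'M[C]_(m, p)) : real_mx M <-> M \is a realmx.
Proof. by split=> [h|/mxOverP h]; [apply/mxOverP|]. Qed.

Lemma realmx_conjP m p (M : 'M[C]_(m, p)) : reflect (M ^ conjC = M) (M \is a realmx).
Proof.
apply: (iffP idP) => [/realmxC //|h]; apply/mxOverP=> i j.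
by apply/CrealP; move/matrixP/(_ i j): h; rewrite mxE.
Qed.

Lemma realmx_tr m p (M : 'M[C]_(m, p)) : (M^T \is a realmx) = (M \is a realmx).
Proof.
by apply/mxOverP/mxOverP=> h i j; [have := h j i|]; rewrite mxE.
Qed.

Lemma realmxN m p (M : 'M[C]_(m, p)) : M \is a realmx -> - M \is a realmx.
Proof. by move/mxOverP=> h; apply/mxOverP=> i j; rewrite mxE realN. Qed.

Lemma realmxB m p (M N : 'M[C]_(m, p)) :
  M \is a realmx -> N \is a realmx -> M - N \is a realmx.
Proof. by move=> hM hN; rewrite realmxD // realmxN. Qed.

Lemma realmx1 m : (1%:M : 'M[C]_m) \is a realmx.
Proof. by apply/realmx_conjP; rewrite map_mx1. Qed.

Lemma orthP n (A : 'M[C]_n) :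
  orthogonal_mx A <-> A \is a realmx /\ A *m A^T = 1%:M.
Proof. by split=> -[h1 h2]; split=> //; apply/real_mxP. Qed.

Lemma orth_mulVmx n (A : 'M[C]_n) : orthogonal_mx A -> A^T *m A = 1%:M.
Proof. by case=> _ /mulmx1C. Qed.

Lemma orth_mulmxV n (A : 'M[C]_n) : orthogonal_mx A -> A *m A^T = 1%:M.
Proof. by case. Qed.

Lemma orth_real n (A : 'M[C]_n) : orthogonal_mx A -> A \is a realmx.
Proof. by case/orthP. Qed.

Lemma orth_tr n (A : 'M[C]_n) : orthogonal_mx A -> orthogonal_mx A^T.
Proof.
by move=> hA; apply/orthP; rewrite realmx_tr orth_real // trmxK orth_mulVmx.
Qed.

Lemma orth_mul n (A B : 'M[C]_n) :
  orthogonal_mx A -> orthogonal_mx B -> orthogonal_mx (A *m B).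
Proof.
move=> hA hB; apply/orthP; rewrite mxOverM ?orth_real //; split=> //.
by rewrite trmx_mul mulmxA -(mulmxA A) orth_mulmxV // mulmx1 orth_mulmxV.
Qed.

Lemma orth1 n : orthogonal_mx (1%:M : 'M[C]_n).
Proof. by apply/orthP; rewrite realmx1 trmx1 mulmx1. Qed.

Lemma orth_unit n (A : 'M[C]_n) : orthogonal_mx A -> A \in unitmx.
Proof. by case=> _ /mulmx1_unit[]. Qed.

Lemma orth_unitary n (A : 'M[C]_n) : orthogonal_mx A -> A \is unitarymx.
Proof.
move=> /orthP[rA hA]; apply/unitarymxP.
by rewrite (realmx_conjP _ _) ?realmx_tr.
Qed.

Lemma unitary_normal n (A : 'M[C]_n) : A \is unitarymx -> A \is normalmx.
Proof.
by move=> /unitarymxP h; apply/normalmxP; rewrite h (mulmx1C h).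
Qed.

Lemma dimkerE n (B : 'M[C]_n) l : dimker B l = (n - \rank (B - l%:M)%R)%N.
Proof.
by rewrite /dimker /eigenspace mxrank_ker -mxrank_tr linearB /= trmxK tr_scalar_mx.
Qed.

Lemma dimker_row n (B : 'M[C]_n) l : dimker B l = \rank (eigenspace B l).
Proof. by rewrite dimkerE /eigenspace mxrank_ker. Qed.

Lemma dimker_similar n (A B K : 'M[C]_n) l :
  K \in unitmx -> K *m A = B *m K -> dimker A l = dimker B l.
Proof.
move=> uK h; rewrite !dimkerE; congr (_ - _)%N.
have e : K *m (A - l%:M) = (B - l%:M) *m K.
  by rewrite mulmxBr mulmxBl h scalar_mxC.
by rewrite -(mxrankMfree (B - _) (_ : row_free K)) -?e ?row_free_unit //
  (eqmxMfull _ (_ : row_full K)) // row_full_unit.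
Qed.

(** The upper bound [ub] is subadditivity of the rank. Applied also to the indicator [f] of the
    zeros of [e], it gives the lower bound, because [diag_mx (e + f)] is invertible. *)
Lemma rank_diag_mx n (e : 'rV[C]_n) :
  \rank (diag_mx e) = #|[pred i | e 0 i != 0]|.
Proof.
have ub (f : 'rV[C]_n) : (\rank (diag_mx f) <= #|[pred i | f 0%R i != 0%R]|)%N.
  rewrite diag_mx_sum_delta (bigID [pred i | f 0 i != 0]) /= [X in _ + X]big1.
    rewrite addr0 -sum1_card.
    elim/big_rec2: _ => [|i y1 y2 _ h]; first by rewrite mxrank0.
    apply: leq_trans (mxrank_add _ _) _; apply: leq_add h.
    by apply: leq_trans (mxrank_scale _ _) _; rewrite mxrank_delta.
  by move=> i /negPn/eqP ->; rewrite scale0r.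
apply/eqP; rewrite eqn_leq ub /=.
pose f := \row_i (if e 0 i == 0 then 1 else 0 : C).
have := cardC [pred i | e 0 i != 0]; rewrite card_ord => cn.
have cf : #|[pred i | f 0 i != 0]| = #|[predC [pred i | e 0%R i != 0%R]]|.
  apply: eq_card => i; rewrite !inE mxE negbK.
  by case: ifP => _; rewrite ?oner_eq0 ?eqxx.
have := ub f; rewrite cf => hf.
have : (\rank (diag_mx (e + f)) <= \rank (diag_mx e) + \rank (diag_mx f))%N.
  by rewrite raddfD mxrank_add.
rewrite mxrank_unit; last first.
  rewrite unitmxE det_diag unitfE; apply/prodf_neq0 => i _; rewrite !mxE.
  by case: ifP => [/eqP ->|/negbT]; rewrite ?add0r ?oner_eq0 ?addr0.
move=> h; rewrite -(leq_add2r #|[predC [pred i | e 0%R i != 0%R]]|) cn.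
exact: leq_trans h (leq_add (leqnn _) hf).
Qed.

End LinearAlgebra.

(** * Functional calculus for unitarily diagonalizable matrices *)

Section FunctionalCalculus.
Variable C : numClosedFieldType.

(** For unitary [P], the normal matrix with eigenvalues [d]; mapping [phi] over [d] applies the
    function [phi] to it. *)
Definition udiag n (P : 'M[C]_n) (d : 'rV[C]_n) := P^t* *m diag_mx d *m P.

Lemma unitary_mulVmx n (P : 'M[C]_n) : P \is unitarymx -> P^t* *m P = 1%:M.
Proof. by move/unitarymxP/mulmx1C. Qed.

Lemma orth_spectral n (A : 'M[C]_n) : orthogonal_mx A ->
  exists P d, P \is unitarymx /\ A = udiag P d.
Proof.
move=> /orth_unitary/unitary_normal/orthomx_spectralP eA.
exists (spectralmx A), (spectral_diag A); split; first exact: spectral_unitarymx.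
by rewrite {1}eA invmx_unitary // spectral_unitarymx.
Qed.

Lemma mul_udiag n (P : 'M[C]_n) d : P \is unitarymx ->
  P *m udiag P d = diag_mx d *m P.
Proof. by move=> /unitarymxP uP; rewrite /udiag !mulmxA uP mul1mx. Qed.

Lemma dimker_udiag n (P : 'M[C]_n) d l : P \is unitarymx ->
  dimker (udiag P d) l = count_mem l [tuple d 0 i | i < n].
Proof.
move=> uP; rewrite (dimker_similar _ (unitarymx_unit uP) (mul_udiag d uP)).
rewrite dimkerE -diag_const_mx -raddfB rank_diag_mx.
rewrite -[n in (n - _)%N]card_ord -(cardC [pred i | (d - const_mx l) 0 i != 0]) addKn.
rewrite cardE size_filter count_map -enumT; apply: eq_count => i /=.
by rewrite !inE !mxE negbK subr_eq0.
Qed.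

(** Wherever [T i j] is nonzero the hypothesis forces [d 0 i = e 0 j], so the values of [phi] agree
    there too. *)
Lemma diag_intertwine m p d e (T : 'M[C]_(m, p)) phi :
  diag_mx d *m T = T *m diag_mx e ->
  diag_mx (map_mx phi d) *m T = T *m diag_mx (map_mx phi e).
Proof.
move/matrixP=> eT; apply/matrixP=> i j; move: (eT i j).
rewrite !mul_diag_mx !mul_mx_diag !mxE.
have [->|nz] := eqVneq (T i j) 0; first by rewrite !mul0r !mulr0.
by rewrite mulrC => /(mulfI nz) ->; rewrite mulrC.
Qed.

(** [T] is rectangular so that it can be a matrix in a commutant, an identity between two
    diagonalizations, or a single column. *)
Lemma udiag_intertwine m p (P : 'M[C]_m) d (Q : 'M[C]_p) e (T : 'M[C]_(m, p)) phi :
    P \is unitarymx -> Q \is unitarymx ->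
  udiag P d *m T = T *m udiag Q e ->
  udiag P (map_mx phi d) *m T = T *m udiag Q (map_mx phi e).
Proof.
move=> uP uQ eT; pose T' := P *m T *m Q^t*.
have eT' : diag_mx d *m T' = T' *m diag_mx e.
  rewrite /T' !mulmxA -mul_udiag // -(mulmxA P) eT /udiag !mulmxA.
  by rewrite -[X in X = _]mulmxA (unitarymxP uQ) mulmx1.
have eTT' : T = P^t* *m T' *m Q.
  by rewrite /T' !mulmxA unitary_mulVmx // mul1mx -mulmxA unitary_mulVmx ?mulmx1.
have eP : diag_mx (map_mx phi d) *m T' = T' *m diag_mx (map_mx phi e).
  exact: diag_intertwine.
clearbody T'; rewrite eTT' /udiag !mulmxA -!(mulmxA _ P) (unitarymxP uP) mulmx1.
rewrite -[X in _ = X *m _ *m _]mulmxA (unitarymxP uQ) mulmx1.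
by rewrite -(mulmxA _ (diag_mx _)) eP !mulmxA.
Qed.

Lemma udiag_conj n (P : 'M[C]_n) d : (udiag P d) ^ conjC = udiag (P ^ conjC)%sesqui (d ^ conjC)%sesqui.
Proof. by rewrite /udiag !map_mxM map_diag_mx map_trmx. Qed.

Lemma udiag_adj n (P : 'M[C]_n) d : (udiag P d)^t* = udiag P (d ^ conjC)%sesqui.
Proof.
rewrite /udiag !trmx_mul !map_mxM tr_diag_mx map_diag_mx mulmxA.
by congr (_ *m _); rewrite trmxCK.
Qed.

Lemma udiagM n (P : 'M[C]_n) d e : P \is unitarymx ->
  udiag P d *m udiag P e = udiag P (\row_i (d 0 i * e 0 i)).
Proof.
move=> uP; rewrite /udiag !mulmxA -!(mulmxA _ P) (unitarymxP uP) mulmx1.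
by rewrite -(mulmxA _ (diag_mx d)) mulmx_diag.
Qed.

Lemma udiag1 n (P : 'M[C]_n) : P \is unitarymx -> udiag P (const_mx 1) = 1%:M.
Proof. by move=> uP; rewrite /udiag diag_const_mx mulmx1 unitary_mulVmx. Qed.

Lemma udiag_inj n (P : 'M[C]_n) d e : P \is unitarymx -> udiag P d = udiag P e -> d = e.
Proof.
move=> uP /(congr1 (fun X => P *m X *m P^t*)).
rewrite !mul_udiag // -!mulmxA (unitarymxP uP) !mulmx1 => /matrixP h.
by apply/rowP=> i; move: (h i i); rewrite !mxE eqxx !mulr1n.
Qed.

Lemma udiag_unitaryP n (P : 'M[C]_n) d : P \is unitarymx ->
  udiag P d \is unitarymx <-> forall i, d 0 i * (d 0 i)^* = 1.
Proof.
move=> uP; split=> [/unitarymxP|h].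
  rewrite udiag_adj udiagM // -(udiag1 uP) => /(udiag_inj uP)/rowP h i.
  by have := h i; rewrite !mxE.
apply/unitarymxP; rewrite udiag_adj udiagM // -(udiag1 uP); congr udiag.
by apply/rowP=> i; rewrite !mxE h.
Qed.

(** A real matrix is also diagonalized by the conjugates of [P] and [d]; the identity intertwines
    both forms, hence also their images under [phi]. *)
Lemma udiag_real n (P : 'M[C]_n) d phi : P \is unitarymx ->
    udiag P d \is a realmx ->
    (forall i, phi (d 0 i)^* = (phi (d 0 i))^*) ->
  udiag P (map_mx phi d) \is a realmx.
Proof.
move=> uP /realmx_conjP; rewrite udiag_conj => er hphi; apply/realmx_conjP.
have uP' : (P ^ conjC)%sesqui \is unitarymx by rewrite conjC_unitary.
have := @udiag_intertwine _ _ P d (P ^ conjC)%sesqui (d ^ conjC)%sesqui 1%:M phi uP uP'.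
rewrite er !mulmx1 !mul1mx => /(_ erefl) eu; rewrite [RHS]eu udiag_conj; congr udiag.
by apply/rowP=> i; rewrite !mxE hphi.
Qed.

(** [R] is the inverse square root of [S^T *m S], a function of that matrix, so it commutes with the
    whole commutant. *)
Lemma posdef_inv_sqrt n (S : 'M[C]_n) : S \is a realmx -> S \in unitmx ->
  exists R : 'M[C]_n, [/\ R \is a realmx, R^T = R, R *m (S^T *m S) *m R = 1%:M &
    forall X, X *m (S^T *m S) = (S^T *m S) *m X -> X *m R = R *m X].
Proof.
move=> rS uS; set H := S^T *m S.
have rH : H \is a realmx by rewrite mxOverM ?realmx_tr.
have sH : H^T = H by rewrite trmx_mul trmxK.
have nH : H \is normalmx.
  by apply/normalmxP; rewrite sH (realmx_conjP _ rH).
set U := spectralmx H; set e := spectral_diag H.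
have uU : U \is unitarymx := spectral_unitarymx H.
have eH : H = udiag U e.
  by move/orthomx_spectralP: nH => ->; rewrite invmx_unitary.
(* Each eigenvalue is the squared Hermitian norm of a column of [S *m U^t*], and invertibility
   excludes 0. *)
have e_gt0 i : 0 < e 0 i.
  have eD : diag_mx e = (S *m U^t*)^t* *m (S *m U^t*).
    rewrite trmx_mul map_mxM trmxCK [S^t*](realmx_conjP _ _) ?realmx_tr // !mulmxA.
    by rewrite -(mulmxA U) -/H eH mul_udiag // -mulmxA (unitarymxP uU) mulmx1.
  have uH : H \in unitmx by rewrite unitmx_mul unitmx_tr uS.
  rewrite lt_neqAle eq_sym; apply/andP; split.
    move: uH; rewrite eH /udiag !unitmx_mul => /andP[/andP[_ +] _].
    by rewrite unitmxE det_diag unitfE => /prodf_neq0/(_ i isT).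
  move/matrixP/(_ i i): eD; rewrite !mxE eqxx mulr1n => ->.
  by apply: sumr_ge0 => k _; rewrite !mxE mulrC mul_conjC_ge0.
pose phi (x : C) := (sqrtC x)^-1.
have phi_real i : phi (e 0 i) \is Num.real.
  by apply: ger0_real; rewrite invr_ge0 sqrtC_ge0 ltW.
have rR : udiag U (map_mx phi e) \is a realmx.
  apply: udiag_real; rewrite -?eH // => i.
  rewrite (CrealP (phi_real i)) (CrealP _) //; exact: gtr0_real.
exists (udiag U (map_mx phi e)); split=> //.
- rewrite -[LHS](realmx_conjP _ _) ?realmx_tr // udiag_adj; congr udiag.
  by apply/rowP=> i; rewrite !mxE (CrealP (phi_real i)).
- rewrite eH !udiagM // -(udiag1 uU); congr udiag; apply/rowP=> i.
  rewrite !mxE /phi; set x := sqrtC _.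
  have xnz : x != 0 by rewrite sqrtC_eq0 gt_eqF.
  by rewrite -[e 0 i]sqrtCK -/x; field.
- by rewrite eH => X /esym /(udiag_intertwine phi uU uU) ->.
Qed.

Lemma orth_similar_dimker n (A B : 'M[C]_n) :
    orthogonal_mx A -> orthogonal_mx B -> (forall l, dimker A l = dimker B l) ->
  exists K : 'M[C]_n, orthogonal_mx K /\ K *m A = B *m K.
Proof.
move=> oA oB eAB.
have [S [rS uS eS]] : exists S : 'M[C]_n,
    [/\ S \is a realmx, S \in unitmx & S *m A = B *m S].
  have [P [d [uP eA]]] := orth_spectral oA.
  have [Q [e [uQ eB]]] := orth_spectral oB.
  have : perm_eq [tuple d 0 i | i < n] [tuple e 0 i | i < n].
    by apply/allP=> l _ /=; rewrite -(dimker_udiag d _ uP) -(dimker_udiag e _ uQ) -eA -eB eAB.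
  case/tuple_permP=> s es.
  have de i : d 0 i = e 0 (s i).
    move/(congr1 (fun t : seq C => nth 0 t i)): es.
    by rewrite -!tnth_nth !tnth_mktuple.
  (* [real_similar] turns a complex similarity of real matrices into a real one; the complex one
     comes from permuting eigenvalues. *)
  suff : similar_in unitmx A B.
    move=> /real_similar/(_ (orth_real oA) (orth_real oB)) [S /andP[rS uS]].
    by move/(similarP uS) => h; exists S.
  have uV : Q^t* *m (perm_mx s)^T *m P \in unitmx.
    by rewrite !unitmx_mul unitmx_tr unitmx_perm !unitarymx_unit ?trmxC_unitary.
  exists (Q^t* *m (perm_mx s)^T *m P) => //; apply/(similarP uV).
  rewrite eA eB -!mulmxA mul_udiag // /udiag !mulmxA -!(mulmxA _ Q).
  rewrite (unitarymxP uQ) mulmx1; congr (_ *m _); rewrite -!mulmxA; congr (_ *m _).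
  apply/matrixP=> i j; rewrite mul_diag_mx mul_mx_diag !mxE.
  by have [<-|_] := eqVneq (s j) i; rewrite ?mulr1 ?mul1r ?mulr0 ?mul0r ?de.
have [R [rR sR eR cR]] := posdef_inv_sqrt rS uS.
(* Together with [eS] this shows that [A] commutes with [S^T *m S], hence with [R]. *)
have eS' : S^T *m B = A *m S^T.
  have e1 : S = B *m S *m A^T by rewrite -eS -mulmxA orth_mulmxV // mulmx1.
  by rewrite {1}e1 !trmx_mul trmxK -!mulmxA orth_mulVmx // mulmx1.
have cA : A *m R = R *m A by apply: cR; rewrite mulmxA -eS' -!mulmxA eS.
exists (S *m R); split; last by rewrite -mulmxA -cA !mulmxA eS.
apply/orthP; split; first by rewrite mxOverM.
apply: mulmx1C; rewrite trmx_mul sR -eR !mulmxA; congr (_ *m _).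
Qed.

End FunctionalCalculus.

(** * Renaming eigenvalues and adjusting translation parts *)

Section Matching.
Variable C : numClosedFieldType.

Lemma orth_eigen_norm n (A : 'M[C]_n) l :
  orthogonal_mx A -> (0 < dimker A l)%N -> l * l^* = 1.
Proof.
move=> oA; have [P [d [uP eA]]] := orth_spectral oA.
rewrite eA dimker_udiag // -has_count => /hasP[_ /mapP[i _ ->] /eqP <-].
by have := orth_unitary oA; rewrite eA => /(udiag_unitaryP _ uP); apply.
Qed.

(** [A'] is the function [th] of [A]: unitary because eigenvalues of [B] have modulus 1, real
    because [th] respects conjugation. An inverse of [th] on the spectrum gives [A] back as a
    function of [A']. *)
Lemma orth_match n (A B : 'M[C]_n) (th : C -> C) :
    orthogonal_mx A -> orthogonal_mx B ->
    (forall l, (0 < dimker A l)%N -> dimker B (th l) = dimker A l) ->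
    (forall l m, (0 < dimker A l)%N -> (0 < dimker A m)%N -> th l = th m -> l = m) ->
    (forall l, (0 < dimker A l)%N -> th l^* = (th l)^*) ->
    th 1 = 1 -> (forall l, (0 < dimker A l)%N -> th l = 1 -> l = 1) ->
  exists (K A' : 'M[C]_n), [/\ orthogonal_mx K, orthogonal_mx A', K *m A' = B *m K,
    forall X, X *m A = A *m X <-> X *m A' = A' *m X &
    forall x : 'cV_n, A *m x = x <-> A' *m x = x].
Proof.
move=> oA oB dth injth conjth th1 th1V.
have [P [d [uP eA]]] := orth_spectral oA.
pose dd := [tuple d 0 i | i < n].
have eigd l : (0 < dimker A l)%N = (l \in dd).
  by rewrite eA dimker_udiag // -has_count has_pred1.
have dnz i : (0 < dimker A (d 0%R i))%N.
  by rewrite eigd; apply/mapP; exists i; rewrite ?mem_enum.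
pose A' := udiag P (map_mx th d).
have uA' : A' \is unitarymx.
  apply/(udiag_unitaryP _ uP) => i; rewrite mxE.
  by apply: (orth_eigen_norm oB); rewrite dth.
have rA' : A' \is a realmx by apply: udiag_real; rewrite -?eA ?orth_real // => i; apply: conjth.
have oA' : orthogonal_mx A'.
  apply/orthP; split=> //; move/unitarymxP: uA'.
  by rewrite (realmx_conjP _ _) ?realmx_tr.
have [Q [e [uQ eB]]] := orth_spectral oB.
pose ee := [tuple e 0 i | i < n].
have edd : [tuple (map_mx th d) 0 i | i < n] = map th dd :> seq C.
  by rewrite -map_comp; apply: eq_map => i /=; rewrite mxE.
have pe : perm_eq (map th dd) ee.
  (* Only eigenvalues [th l] are controlled, but their multiplicities already add up to [n], so
     inclusion of multisets is equality. *)
  have /count_subseqP[s ss ps] l : (count_mem l (map th dd) <= count_mem l ee)%N.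
    have [/mapP[l0 l0d ->]|/count_memPn-> //] := boolP (l \in map th dd).
    rewrite count_map -(dimker_udiag e _ uQ) -eB dth ?eigd //.
    rewrite eA dimker_udiag // -/dd; apply: eq_leq; apply: eq_in_count => x xd /=.
    by apply/eqP/eqP=> [|-> //]; apply: injth; rewrite ?eigd.
  have /eqP es : s == ee.
    rewrite -(size_subseq_leqif ss).2 -(perm_size ps) size_map !size_tuple //.
  by rewrite -es.
have [K [oK eK]] : exists K : 'M[C]_n, orthogonal_mx K /\ K *m A' = B *m K.
  apply: orth_similar_dimker => // l.
  by rewrite eB !dimker_udiag // edd; have /seq.permP := pe; apply.
(* The default 1 ensures [psi 1 = 1] even if 1 is not an eigenvalue. *)
pose psi m := head 1 [seq l <- dd | th l == m].
have psid i : psi (th (d 0 i)) = d 0 i.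
  have : d 0 i \in [seq l <- dd | th l == th (d 0 i)].
    by rewrite mem_filter eqxx -eigd dnz.
  rewrite /psi; case E: [seq _ <- _ | _] => [//|x s] _ /=.
  have : x \in [seq l <- dd | th l == th (d 0 i)] by rewrite E mem_head.
  by rewrite mem_filter -eigd => /andP[/eqP h1 h2]; apply: injth.
have psi1 : psi 1 = 1.
  rewrite /psi; case E: [seq _ <- _ | _] => [//|x s] /=.
  have : x \in [seq l <- dd | th l == 1] by rewrite E mem_head.
  by rewrite mem_filter -eigd => /andP[/eqP h1 h2]; apply: th1V.
have psiA : A = udiag P (map_mx psi (map_mx th d)).
  by rewrite eA; congr udiag; apply/rowP=> i; rewrite !mxE psid.
have u1 : (1%:M : 'M[C]_1) \is unitarymx by exact: orth_unitary (orth1 _ _).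
exists K, A'; split=> //.
- move=> X; split=> /esym h; apply: esym.
    by move: h; rewrite eA; apply: udiag_intertwine.
  by move: h; rewrite psiA; apply: udiag_intertwine.
(* A fixed column intertwines the matrix with the 1 by 1 identity. *)
- move=> x; split.
    rewrite -{2}(mulmx1 x) -(udiag1 u1) eA => /(udiag_intertwine th uP u1).
    by rewrite map_const_mx th1 udiag1 ?mulmx1.
  rewrite -{2}(mulmx1 x) -(udiag1 u1) psiA => /(udiag_intertwine psi uP u1).
  by rewrite map_const_mx psi1 udiag1 ?mulmx1.
Qed.

(** Moving the origin changes [a] into [a + t - A *m t]; in an eigenbasis this can cancel all
    components of [a] at eigenvalues other than 1. *)
Lemma fixed_part n (A : 'M[C]_n) (a : 'cV[C]_n) : orthogonal_mx A -> a \is a realmx ->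
  exists t : 'cV[C]_n, t \is a realmx /\ A *m (a + t - A *m t) = a + t - A *m t.
Proof.
move=> oA ra; have [P [d [uP eA]]] := orth_spectral oA.
(* Where [d 0 i] is 1, division by zero gives 0 and the component of [a] is kept. *)
pose y := \col_i (- (P *m a) i 0 / (1 - d 0 i)).
pose t := P^t* *m y.
have ht : A *m (a + t - A *m t) = a + t - A *m t.
  apply: (can_inj (mulKmx (unitarymx_unit uP))).
  have ePA x : P *m (A *m x) = diag_mx d *m (P *m x).
    by rewrite mulmxA eA mul_udiag // mulmxA.
  have ez : P *m (a + t - A *m t) = P *m a + y - diag_mx d *m y.
    by rewrite mulmxBr mulmxDr ePA /t (mulmxA P) (unitarymxP uP) mul1mx.
  rewrite ePA ez; set w := P *m a; rewrite /y -/w; clearbody w.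
  apply/colP=> i; rewrite !mul_diag_mx !mxE.
  have [->|nz] := eqVneq (d 0 i) 1; first by rewrite subrr invr0; ring.
  by field; rewrite subr_eq0 eq_sym.
have rA := realmx_conjP _ (orth_real oA).
(* As [A] and [a] are real, the conjugate of [t] is a solution too, and the mean of both is a real
   one. *)
clearbody t; pose tc := map_mx conjC t.
pose u := 2^-1 *: (t + tc).
have ht' : A *m (a + tc - A *m tc) = a + tc - A *m tc.
  move/(congr1 (map_mx conjC)): ht.
  by rewrite !(map_mxM, map_mxD, map_mxN) /= rA (realmx_conjP _ ra).
have eu : a + u - A *m u = 2^-1 *: ((a + t - A *m t) + (a + tc - A *m tc)).
  rewrite /u -!scalemxAr mulmxDr; by apply/matrixP=> i j; rewrite !mxE; field.
exists u; split; last by rewrite eu -scalemxAr mulmxDr ht ht'.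
apply/realmx_conjP; rewrite map_mxZ map_mxD map_mxCK addrC; congr (_ *: _).
by apply: (CrealP _); rewrite rpredV realn.
Qed.

Lemma dotmx_real_eq0 n (a : 'cV[C]_n) : a \is a realmx -> (a^T *m a) 0 0 = 0 -> a = 0.
Proof.
move=> /mxOverP ra; rewrite mxE => /psumr_eq0P h; apply/colP=> i; rewrite mxE.
have hi : 0 <= a^T 0 i * a i 0 by rewrite mxE -expr2 real_exprn_even_ge0.
have := h _ i isT; rewrite mxE => /(_ _)/eqP; rewrite mulf_eq0 orbb => H; apply/eqP/H.
by move=> k _; rewrite mxE -expr2 real_exprn_even_ge0.
Qed.

Lemma dotmx_real_ge0 n (a : 'cV[C]_n) : a \is a realmx -> 0 <= (a^T *m a) 0 0.
Proof.
by move=> /mxOverP ra; rewrite mxE sumr_ge0 // => k _; rewrite mxE -expr2 real_exprn_even_ge0.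
Qed.

(* The reflection exchanging u and w; it commutes with B because u - w is fixed by B. *)
Lemma fixed_vector_reflection n (B : 'M[C]_n) (u w : 'cV[C]_n) : orthogonal_mx B ->
    u \is a realmx -> w \is a realmx -> B *m u = u -> B *m w = w ->
    u^T *m u = w^T *m w ->
  exists H : 'M[C]_n, [/\ orthogonal_mx H, H *m B = B *m H & H *m u = w].
Proof.
move=> oB ru rw Bu Bw euw.
have [->|nuw] := eqVneq u w.
  by exists 1%:M; rewrite !mul1mx mulmx1; split=> //; exact: orth1.
pose z := u - w; pose N := (z^T *m z) 0 0.
have rz : z \is a realmx by exact: realmxB.
have eN : z^T *m z = N%:M by rewrite [LHS]mx11_scalar.
have Nnz : N != 0.
  by apply: contra_neq nuw => /(dotmx_real_eq0 rz)/eqP; rewrite subr_eq0 => /eqP.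
have rN : N \is Num.real.
  have : z^T *m z \is a realmx by rewrite mxOverM ?realmx_tr.
  by move/mxOverP; apply.
pose H := 1%:M - (2 / N) *: (z *m z^T).
have tH : H^T = H.
  by rewrite /H linearB linearZ /= trmx_mul trmxK trmx1.
have rH : H \is a realmx.
  apply: realmxB; first exact: realmx1.
  apply: mxOverZ; first by rewrite rpred_div ?realn.
  by apply: mxOverM; rewrite ?realmx_tr.
have Bz : B *m z = z by rewrite mulmxBr Bu Bw.
have zB : z^T *m B = z^T.
  by apply: trmx_inj; rewrite trmx_mul trmxK -{1}Bz mulmxA orth_mulVmx ?mul1mx.
exists H; split.
- apply/orthP; split=> //; rewrite tH /H.
  have : (z *m z^T) *m (z *m z^T) = N *: (z *m z^T).
    by rewrite mulmxA -(mulmxA z) eN mul_mx_scalar -scalemxAl.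
  move: (z *m z^T) => M MM; rewrite mulmxBl mul1mx mulmxBr mulmx1.
  rewrite -scalemxAl -scalemxAr MM.
  by apply/matrixP=> i j; rewrite !mxE; field.
- by rewrite /H mulmxBl mulmxBr mul1mx mulmx1 -scalemxAl -scalemxAr -mulmxA zB mulmxA Bz.
(* Here the equal norms of [u] and [w] enter; [H] then subtracts exactly [z] from [u]. *)
- have zu : z^T *m u = (N / 2)%:M.
    have e2 : N%:M = z^T *m u + z^T *m u :> 'M_1.
      rewrite -eN {2}/z mulmxBr.
      have -> : z^T *m w = - (z^T *m u); last by rewrite opprK.
      rewrite /z linearB /= !mulmxBl euw opprB.
      by rewrite [w^T *m u]mx11_scalar -tr_scalar_mx -mx11_scalar trmx_mul trmxK.
    rewrite [LHS]mx11_scalar; congr (_%:M).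
    by move/matrixP/(_ 0 0): e2; rewrite !mxE eqxx mulr1n => ->; field.
  rewrite /H mulmxBl mul1mx -scalemxAl -mulmxA zu mul_mx_scalar scalerA.
  rewrite [X in X *: _](_ : _ = 1) ?scale1r ?subKr //.
  by field.
Qed.

End Matching.

(** * The Segre symbol in terms of kernel dimensions *)

Section Segre.
Variable C : numClosedFieldType.

(** The complement is bilinear, but the fixed space of a real [A] is stable under conjugation, so a
    vector in both is orthogonal to its own conjugate and has Hermitian norm 0. *)
Lemma phiR_dim1 n (A : 'M[C]_n) : orthogonal_mx A -> phiR_dim A 1 = 0%N.
Proof.
move=> oA; apply/eqP; rewrite /phiR_dim mxrank_eq0; apply/eqP.
set E := eigenspace _ _; set M := (_ :&: _)%MS.
have ME : (M <= E)%MS by exact: capmxSr.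
have MK : M *m E^T = 0 by apply/sub_kermxP; exact: capmxSl.
have /submxP[T eT] : (map_mx conjC M <= E)%MS.
  have rA : map_mx conjC A^T = A^T by apply/realmx_conjP; rewrite realmx_tr orth_real.
  apply/eigenspaceP; move/eigenspaceP: ME => /(congr1 (map_mx conjC)).
  by rewrite map_mxM rA !scale1r.
have MM : M *m (map_mx conjC M)^T = 0 by rewrite eT trmx_mul mulmxA MK mul0mx.
apply/matrixP=> i j; rewrite [RHS]mxE.
move/matrixP/(_ i i): MM; rewrite [RHS]mxE mxE => /psumr_eq0P h.
have h0 k : true -> 0 <= M i k * (map_mx conjC M)^T k i.
  by move=> _; rewrite !mxE mul_conjC_ge0.
by have /eqP := h h0 j isT; rewrite !mxE mul_conjC_eq0 => /eqP.
Qed.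

(** [A] preserves the bilinear product, so the product of an eigenvector for [l] with a fixed vector
    equals [l] times itself and vanishes. *)
Lemma phiR_dim_neq1 n (A : 'M[C]_n) l : orthogonal_mx A -> l != 1 ->
  phiR_dim A l = dimker A l.
Proof.
move=> oA l1; rewrite /phiR_dim /dimker.
set E := eigenspace _ 1; set F := eigenspace _ l.
suff /sub_kermxP/capmx_idPr -> : F *m E^T = 0 by [].
have eE : E *m A^T = E by have /eigenspaceP := submx_refl E; rewrite scale1r.
have eF : F *m A^T = l *: F by have /eigenspaceP := submx_refl F.
have e : F *m E^T = l *: (F *m E^T).
  have eE' : E *m A = E by rewrite -{1}eE -mulmxA orth_mulVmx // mulmx1.
  by rewrite scalemxAl -eF -(mulmxA F) -trmx_mul eE'.
apply/eqP; move/eqP: e; rewrite -subr_eq0 -{1}[F *m E^T]scale1r -scalerBl.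
by rewrite scalemx_eq0 subr_eq0 eq_sym (negPf l1).
Qed.

(** The list chosen by [epsilon] exists because all eigenvalues occur in the finite list [d]; a
    value with positive imaginary part is not 1, so [dimker] can replace [phiR_dim]. *)
Lemma cpairsP n (A : 'M[C]_n) : orthogonal_mx A ->
  uniq (cpairs A) /\
  forall l, (l \in cpairs A) = (0 < 'Im l) && (0 < dimker A l)%N.
Proof.
move=> oA.
have eqd l : (0 < 'Im l) && (0 < phiR_dim A l)%N = (0 < 'Im l) && (0 < dimker A l)%N.
  have [->|l1] := eqVneq l 1; last by rewrite phiR_dim_neq1.
  by rewrite (Creal_ImP _ _) ?ltxx.
suff : uniq (cpairs A) /\ forall l, (l \in cpairs A) = (0 < 'Im l) && (0 < phiR_dim A l)%N.
  by case=> u h; split=> // l; rewrite h eqd.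
refine (epsilon_spec (inhabits [::]) (fun s : seq C => uniq s /\ forall l,
  (l \in s) = (0 < 'Im l) && (0 < phiR_dim A l)%N) _).
have [P [d [uP eA]]] := orth_spectral oA.
exists (undup [seq l <- [tuple d 0 i | i < n] | 0 < 'Im l]); split=> [|l].
  exact: undup_uniq.
by rewrite mem_undup mem_filter eqd eA dimker_udiag // -has_count has_pred1.
Qed.

Definition euc n (A : 'M[C]_n) (a : 'cV[C]_n) : 'M[C]_(n + 1) := block_mx A a 0 1%:M.

(* x may be complex; for real A and a its real part is then also a solution. *)
Definition has_fixpoint n (A : 'M[C]_n) (a : 'cV[C]_n) := exists x, a = x - A *m x.

(** Augmenting [A - 1%:M] by the column [a] keeps the rank exactly when [a] lies in its image, which
    up to sign is the fixed point equation. *)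
Lemma dimker_euc n (A : 'M[C]_n) (a : 'cV[C]_n) :
  dimker (euc A a) 1 == (dimker A 1).+1 <-> has_fixpoint A a.
Proof.
have rA : \rank (A - 1%:M) = \rank (A - 1%:M)^T by rewrite mxrank_tr.
have rE : \rank (euc A a - 1%:M) = \rank ((A - 1%:M)^T + a^T)%MS.
  rewrite (scalar_mx_block n 1) /euc opp_block_mx add_block_mx !subr0 !subrr.
  by rewrite /block_mx row_mx0 -addsmxE addsmx0 addsmxE -tr_row_mx mxrank_tr.
have le := mxrank_leqif_sup (addsmxSl (A - 1%:M)^T a^T).
rewrite !dimkerE rE rA; have := rank_leq_row (A - 1%:M)^T.
move: le; set rk := \rank _; set rk' := \rank _ => le rkn.
have -> : ((n + 1 - rk')%N == (n - rk).+1) = (rk == rk').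
  by have := le.1; move=> l1; apply/idP/idP => /eqP h; apply/eqP; lia.
rewrite le.2 addsmx_sub submx_refl /=; split.
  case/submxP=> T eT; exists (- T^T).
  by rewrite -[a]trmxK eT trmx_mul trmxK mulmxBl mul1mx mulmxN opprK addrC.
case=> x ->; apply/submxP; exists (- x^T).
by rewrite -{1}[x]mul1mx -mulmxBl trmx_mul -opprB linearN /= mulmxN mulNmx.
Qed.

Lemma segreP n (A B : 'M[C]_n) (a b : 'cV[C]_n) :
  orthogonal_mx A -> orthogonal_mx B ->
  segre (euc A a) = segre (euc B b) <->
  [/\ has_fixpoint A a <-> has_fixpoint B b, dimker A 1 = dimker B 1,
      dimker A (-1) = dimker B (-1) &
      perm_eq [seq dimker A l | l <- cpairs A] [seq dimker B l | l <- cpairs B]].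
Proof.
move=> oA oB.
have m1 : -1 != 1 :> C by rewrite eq_sym -subr_eq0 opprK paddr_eq0 ?oner_eq0.
have ecp (D : 'M[C]_n) : orthogonal_mx D ->
    [seq phiR_dim D l | l <- cpairs D] = [seq dimker D l | l <- cpairs D].
  move=> oD; apply/eq_in_map => l; rewrite (cpairsP oD).2 => /andP[l0 _].
  apply: phiR_dim_neq1 => //; apply: contraTneq l0 => ->.
  by rewrite (Creal_ImP _ _) ?ltxx.
rewrite /segre /lin_part !block_mxKul /= !phiR_dim1 // !phiR_dim_neq1 // !ecp //=.
have sortP := perm_sortP leq_total leq_trans anti_leq.
have eT : (if dimker (euc A a) 1 == (dimker A 1).+1 then Elliptic else Hyperbolic) =
    (if dimker (euc B b) 1 == (dimker B 1).+1 then Elliptic else Hyperbolic) <->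
    (has_fixpoint A a <-> has_fixpoint B b).
  have tT : is_true true by [].
  have tF : ~ is_true false by [].
  case: (_ == _) (dimker_euc A a) => hA; case: (_ == _) (dimker_euc B b) => hB;
    by split=> h; first [discriminate h | reflexivity | tauto | exfalso; tauto].
have eS (D : 'M[C]_n) : orthogonal_mx D ->
    sort leq [seq phiR_dim D e | e <- if (0 < dimker D (-1))%N then [:: -1] else [::]] =
    nseq (0 < dimker D (-1))%N (dimker D (-1)).
  by move=> oD; case: posnP => [->|] //=; rewrite phiR_dim_neq1.
(* The value at 1 has dropped out, so the real part of the symbol is the multiplicity of -1, or the
   empty list if that is 0. *)
have eN x y : nseq (0 < x)%N x = nseq (0 < y)%N y <-> x = y.
  by split=> [|->] //; case: x y => [|x] [|y] //= [->].
rewrite !eS //.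
split=> [[] |[] h1 h2 h3 h4].
  by move=> /eT h1 h2 /sortP h3 /eN h4.
by congr (_, _, _, _) => //; [apply/eT|apply/sortP|apply/eN].
Qed.

Lemma orth_eigen_real n (A : 'M[C]_n) l : orthogonal_mx A -> (0 < dimker A l)%N ->
  l \is Num.real -> (l == 1) || (l == -1).
Proof.
move=> oA el /CrealP rl; have := orth_eigen_norm oA el.
by rewrite rl -expr2 => /eqP; rewrite sqrf_eq1.
Qed.

Lemma dimker_conj n (A : 'M[C]_n) l : A \is a realmx -> dimker A l^* = dimker A l.
Proof.
move=> rA; rewrite !dimkerE -(mxrank_map conjC (A - l%:M)) map_mxB map_scalar_mx /=.
by rewrite (realmx_conjP _ rA).
Qed.

Lemma perm_map_matching (T U V : eqType) (u0 : U) (F : T -> V) (G : U -> V) s t :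
  perm_eq [seq F x | x <- s] [seq G y | y <- t] ->
  exists2 t', perm_eq t' t & [seq F x | x <- s] = [seq G y | y <- t'].
Proof.
case: t => [|u t] h.
  by exists [::] => //; apply/eqP; rewrite -size_eq0 (perm_size h).
move: h; set t1 := u :: t => /(perm_iotaP (G u))[Is pI ->].
exists [seq nth u0 t1 i | i <- Is].
  apply/(perm_iotaP u0); exists Is => //; by rewrite size_map in pI.
rewrite -map_comp; apply/eq_in_map=> i; rewrite (perm_mem pI) mem_iota size_map add0n => hi.
exact: nth_map.
Qed.

(** [R] is a bijection between [s] and [t] given as a relation; choice turns it into a map. *)
Lemma perm_map_rel (T U V : eqType) (u0 : U) (R : T -> U -> Prop) (F : T -> V) (G : U -> V) s t :
    uniq s -> uniq t ->
    (forall x, x \in s -> exists2 y, y \in t & R x y) ->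
    (forall y, y \in t -> exists2 x, x \in s & R x y) ->
    (forall x y y', x \in s -> y \in t -> y' \in t -> R x y -> R x y' -> y = y') ->
    (forall x x' y, x \in s -> x' \in s -> y \in t -> R x y -> R x' y -> x = x') ->
    (forall x y, R x y -> F x = G y) ->
  perm_eq [seq F x | x <- s] [seq G y | y <- t].
Proof.
move=> us ut hs ht hf hi hFG.
pose f x := epsilon (inhabits u0) (fun y => y \in t /\ R x y).
have fP x : x \in s -> f x \in t /\ R x (f x).
  move=> /hs[y yt Rxy].
  by apply: (epsilon_spec (inhabits u0) (fun y => y \in t /\ R x y)); exists y.
have -> : [seq F x | x <- s] = [seq G y | y <- [seq f x | x <- s]].
  by rewrite -map_comp; apply/eq_in_map => x /fP[_ /hFG].
apply: perm_map; apply: uniq_perm => //.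
  rewrite map_inj_in_uniq // => x y xs ys e.
  have [h1 h2] := fP _ xs; have [h3 h4] := fP _ ys; rewrite -e in h3 h4.
  exact: hi h2 h4.
move=> y; apply/mapP/idP => [[x /fP[h _] ->] //|yt].
have [x xs Rxy] := ht _ yt; have [h1 h2] := fP _ xs.
by exists x => //; apply: hf Rxy h2.
Qed.

(** Upper half-plane eigenvalues are matched by multiplicity, conjugation extends this to the lower
    half-plane, and real values stay. [th] keeps the sign of the imaginary part of eigenvalues, so
    injectivity is checked region by region. *)
Lemma segre_match n (A B : 'M[C]_n) : orthogonal_mx A -> orthogonal_mx B ->
    dimker A 1 = dimker B 1 -> dimker A (-1) = dimker B (-1) ->
    perm_eq [seq dimker A l | l <- cpairs A] [seq dimker B l | l <- cpairs B] ->
  exists th : C -> C,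
   [/\ forall l, (0 < dimker A l)%N -> dimker B (th l) = dimker A l,
    forall l m, (0 < dimker A l)%N -> (0 < dimker A m)%N -> th l = th m -> l = m,
    forall l, th l^* = (th l)^*,
    th 1 = 1 & (forall l, (0 < dimker A l)%N -> th l = 1 -> l = 1)].
Proof.
move=> oA oB e1 em1 /(perm_map_matching (0 : C))[t pt emap].
have [us sP] := cpairsP oA; have [ut tP] := cpairsP oB.
have ut' : uniq t by rewrite (perm_uniq pt).
set s := cpairs A in us sP emap.
have est : size s = size t by have := congr1 size emap; rewrite !size_map.
pose up l := nth 0 t (index l s).
have up_in l : l \in s -> up l \in t.
  by move=> ls; rewrite mem_nth // -est index_mem.
have up_Im l : l \in s -> 0 < 'Im (up l).
  by move=> /up_in; rewrite (perm_mem pt) tP => /andP[].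
have up_dim l : l \in s -> dimker B (up l) = dimker A l.
  move=> ls; have := congr1 (fun u => nth 0%N u (index l s)) emap.
  by rewrite !(nth_map 0) -?est ?index_mem // nth_index.
have up_inj l m : l \in s -> m \in s -> up l = up m -> l = m.
  move=> ls ms /eqP; rewrite nth_uniq -?est ?index_mem // => /eqP h.
  by rewrite -(nth_index 0 ls) h nth_index.
pose th l := if 'Im l == 0 then l else if 0 < 'Im l then up l else (up l^*)^*.
have ImC (l : C) : 'Im l^* = - 'Im l by rewrite Im_conj.
have th_real l : 'Im l = 0 -> th l = l by rewrite /th => ->; rewrite eqxx.
have th_pos l : 0 < 'Im l -> th l = up l by move=> h; rewrite /th gt_eqF h.
have th_neg l : 'Im l < 0 -> th l = (up l^*)^*.
  by move=> h; rewrite /th lt_eqF // lt_gtF.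
have cases (l : C) : [\/ 'Im l = 0, 0 < 'Im l | 'Im l < 0].
  by have := real_ltgt0P (Creal_Im l); case=> h; [constructor 2|constructor 3|constructor 1].
have s_pos l : (0 < dimker A l)%N -> 0 < 'Im l -> l \in s.
  by move=> h1 h2; rewrite sP h1 h2.
have s_neg l : (0 < dimker A l)%N -> 'Im l < 0 -> l^* \in s.
  by move=> h1 h2; rewrite sP ImC oppr_gt0 h2 dimker_conj ?orth_real.
have Im_pos l : (0 < dimker A l)%N -> 0 < 'Im l -> 0 < 'Im (th l).
  by move=> h1 h2; rewrite th_pos // up_Im // s_pos.
have Im_neg l : (0 < dimker A l)%N -> 'Im l < 0 -> 'Im (th l) < 0.
  by move=> h1 h2; rewrite th_neg // ImC oppr_lt0 up_Im // s_neg.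
have Im1 : 'Im (1 : C) = 0 by apply/Creal_ImP.
exists th; split.
- move=> l el; case: (cases l) => h.
  + by rewrite th_real //; have /orP[/eqP ->|/eqP ->] // := orth_eigen_real oA el (introT (Creal_ImP l) h).
  + by rewrite th_pos // up_dim // s_pos.
  + rewrite th_neg // dimker_conj ?orth_real // up_dim ?s_neg //.
    by rewrite dimker_conj ?orth_real.
- move=> l m el em eth; case: (cases l) => hl; case: (cases m) => hm.
  + by rewrite -[l]th_real // eth th_real.
  + by have := Im_pos _ em hm; rewrite -eth th_real // hl ltxx.
  + by have := Im_neg _ em hm; rewrite -eth th_real // hl ltxx.
  + by have := Im_pos _ el hl; rewrite eth th_real // hm ltxx.
  + by apply: up_inj; rewrite ?s_pos // -!th_pos.
  + by have := lt_trans (Im_neg _ em hm) (Im_pos _ el hl); rewrite eth ltxx.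
  + by have := Im_neg _ el hl; rewrite eth th_real // hm ltxx.
  + by have := lt_trans (Im_neg _ el hl) (Im_pos _ em hm); rewrite eth ltxx.
  + move: eth; rewrite !th_neg // => /(can_inj conjCK) /up_inj h.
    by apply: (can_inj conjCK); apply: h; exact: s_neg.
- move=> l; case: (cases l) => h.
  + by rewrite !th_real ?ImC ?h ?oppr0.
  + by rewrite th_neg ?ImC ?oppr_lt0 // conjCK th_pos.
  + by rewrite th_pos ?ImC ?oppr_gt0 // th_neg // conjCK.
- exact: th_real.
- move=> l el e; case: (cases l) => h.
  + by rewrite -[l]th_real.
  + by have := Im_pos _ el h; rewrite e Im1 ltxx.
  + by have := Im_neg _ el h; rewrite e Im1 ltxx.
Qed.

End Segre.

(** * Isometries, and equal symbols give conjugate centralizers *)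

Section Euclidean.
Variables (C : numClosedFieldType) (n : nat).
Implicit Types (A B K X : 'M[C]_n) (a b x : 'cV[C]_n) (f g h k : 'M[C]_(n + 1)).

Lemma isEucP f :
  isEuc f <-> exists A a, [/\ orthogonal_mx A, a \is a realmx & f = euc A a].
Proof.
by split=> [] [A [a]] => [[oA [/real_mxP ra ->]]|[oA ra ->]]; exists A, a; split=> //;
  split=> //; apply/real_mxP.
Qed.

Lemma isEuc_euc A a : orthogonal_mx A -> a \is a realmx -> isEuc (euc A a).
Proof. by move=> oA ra; apply/isEucP; exists A, a. Qed.

Lemma euc_mul A a B b : euc A a *m euc B b = euc (A *m B) (A *m b + a).
Proof.
by rewrite /euc mulmx_block !mulmx0 !mul0mx !mulmx1 ?mul1mx ?addr0 ?add0r.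
Qed.

Lemma euc_inj A a B b : euc A a = euc B b -> A = B /\ a = b.
Proof. by case/eq_block_mx. Qed.

Lemma euc1 : euc (1%:M : 'M[C]_n) 0 = 1%:M.
Proof. by rewrite /euc -scalar_mx_block. Qed.

Lemma invmx_eq (R : comUnitRingType) m (M N : 'M[R]_m) : M *m N = 1%:M -> invmx M = N.
Proof.
by move=> h; have [uM _] := mulmx1_unit h; rewrite -[N](mulKmx uM) h mulmx1.
Qed.

Lemma invmx_euc A a : orthogonal_mx A -> invmx (euc A a) = euc A^T (- (A^T *m a)).
Proof.
move=> oA; apply: invmx_eq; rewrite euc_mul orth_mulmxV // mulmxN mulmxA orth_mulmxV //.
by rewrite mul1mx addNr euc1.
Qed.

Lemma isEuc_unit k : isEuc k -> k \in unitmx.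
Proof.
case/isEucP=> A [a [oA ra ->]].
have /mulmx1_unit[] // : euc A a *m euc A^T (- (A^T *m a)) = 1%:M.
by rewrite euc_mul orth_mulmxV // mulmxN mulmxA orth_mulmxV // mul1mx addNr euc1.
Qed.

Lemma isEuc_inv k : isEuc k -> isEuc (invmx k).
Proof.
case/isEucP=> A [a [oA ra ->]]; rewrite invmx_euc //.
by apply: isEuc_euc; [exact: orth_tr|rewrite realmxN // mxOverM // realmx_tr orth_real].
Qed.

Lemma isEuc_mul f g : isEuc f -> isEuc g -> isEuc (f *m g).
Proof.
case/isEucP=> A [a [oA ra ->]] /isEucP[B [b [oB rb ->]]]; rewrite euc_mul.
by apply: isEuc_euc; [exact: orth_mul|rewrite realmxD // mxOverM // orth_real].
Qed.

Lemma isEuc1 : isEuc (1%:M : 'M[C]_(n + 1)).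
Proof. by rewrite -euc1; apply: isEuc_euc; [exact: orth1|exact: mxOver0]. Qed.

Lemma centralizer_eucP A a X x :
  centralizer (euc A a) (euc X x) <->
  [/\ orthogonal_mx X, x \is a realmx, X *m A = A *m X & X *m a + x = A *m x + a].
Proof.
split=> [[/isEucP[Y [y [oY ry /euc_inj[-> ->]]]]]|[oX rx c1 c2]].
  by rewrite !euc_mul => /euc_inj[].
by split; [exact: isEuc_euc|rewrite !euc_mul c1 c2].
Qed.

Lemma conj_centralizers_trans f g h :
  conj_centralizers f g -> conj_centralizers g h -> conj_centralizers f h.
Proof.
move=> [k [ek hk]] [l [el hl]]; exists (k *m l); split; first exact: isEuc_mul.
move=> m; rewrite hk hl.
have -> : invmx (k *m l) = invmx l *m invmx k.
  apply: invmx_eq; rewrite mulmxA -(mulmxA k) mulmxV ?isEuc_unit // mulmx1 mulmxV //.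
  exact: isEuc_unit.
by rewrite !mulmxA.
Qed.

Lemma conj_centralizers_sym f g : conj_centralizers f g -> conj_centralizers g f.
Proof.
move=> [k [ek hk]]; exists (invmx k); split; first exact: isEuc_inv.
move=> m; rewrite hk invmxK !mulmxA mulVmx ?isEuc_unit // mul1mx.
by rewrite -mulmxA mulVmx ?isEuc_unit // mulmx1.
Qed.

Lemma conj_centralizers_eq f g :
  (forall h, centralizer f h <-> centralizer g h) -> conj_centralizers f g.
Proof.
move=> h; exists 1%:M; split; first exact: isEuc1.
by move=> m; rewrite invmx1 mul1mx mulmx1.
Qed.

Lemma centralizer_conj f g k : isEuc k -> f *m k = k *m g ->
  forall h, centralizer f h <-> centralizer g (invmx k *m h *m k).
Proof.
move=> ek fk m.
have uk := isEuc_unit ek.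
have eg : g = invmx k *m f *m k by rewrite -mulmxA fk mulKmx.
split=> [[em c]|[em c]]; split.
- by apply: isEuc_mul => //; apply: isEuc_mul => //; exact: isEuc_inv.
- by rewrite eg !mulmxA !(mulmxK uk) -!(mulmxA (invmx k)) c.
- have -> : m = k *m (invmx k *m m *m k) *m invmx k by rewrite !mulmxA mulmxV // mul1mx mulmxK.
  by apply: isEuc_mul; [exact: isEuc_mul|exact: isEuc_inv].
- have : k *m (invmx k *m m *m k *m g) *m invmx k = k *m (g *m (invmx k *m m *m k)) *m invmx k.
    by rewrite c.
  by rewrite eg !mulmxA !(mulmxK uk) !mulmxV // !mul1mx.
Qed.

Lemma conj_centralizers_conj f g k :
  isEuc k -> f *m k = k *m g -> conj_centralizers f g.
Proof. by move=> ek fk; exists k; split=> //; exact: centralizer_conj. Qed.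

(** With a fixed point, [a0] lies both in the fixed space of [A] and in the image of [1 - A], which
    are orthogonal. *)
Lemma fixed_normal_form A a : orthogonal_mx A -> a \is a realmx ->
  exists a0, [/\ a0 \is a realmx, A *m a0 = a0, conj_centralizers (euc A a) (euc A a0) &
    has_fixpoint A a <-> a0 = 0].
Proof.
move=> oA ra; have [t [rt et]] := fixed_part oA ra.
exists (a + t - A *m t); split=> //.
- by rewrite realmxB ?realmxD // mxOverM ?orth_real.
- apply: conj_centralizers_sym; apply: (conj_centralizers_conj (k := euc 1%:M t)).
    by apply: isEuc_euc => //; exact: orth1.
  by rewrite !euc_mul !mulmx1 !mul1mx addrC subrK addrC.
- split=> [[x ea]|]; last first.
    by move/eqP; rewrite subr_eq0 => /eqP h; exists (- t); rewrite mulmxN opprK -h addrC addrK.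
  have ea0 : a + t - A *m t = (x + t) - A *m (x + t).
    by rewrite ea mulmxDr opprD addrACA addrA.
  have ra0 : a + t - A *m t \is a realmx by rewrite realmxB ?realmxD // mxOverM ?orth_real.
  move: et ra0 ea0; move: (a + t - A *m t) (x + t) => a0 y et ra0 ea0.
  apply: (dotmx_real_eq0 ra0).
  rewrite {2}ea0 mulmxBr mulmxA.
  have -> : a0^T *m A = a0^T by rewrite -{1}et trmx_mul -mulmxA orth_mulVmx // mulmx1.
  by rewrite subrr mxE.
Qed.

(** As [A] fixes [a], commutation splits into [X *m a = a] and [A *m x = x] besides the linear part;
    these depend only on the commutant, the fixed vectors and the line of [a]. *)
Lemma centralizer_transport A A' a c : c \is Num.real -> c != 0 ->
    orthogonal_mx A -> orthogonal_mx A' -> A *m a = a ->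
    (forall X, X *m A = A *m X <-> X *m A' = A' *m X) ->
    (forall x, A *m x = x <-> A' *m x = x) ->
  forall h, centralizer (euc A a) h <-> centralizer (euc A' (c *: a)) h.
Proof.
move=> rc c0 oA oA' Aa hX hx.
have fixedP B b X x : orthogonal_mx B -> B *m b = b -> X *m B = B *m X ->
    X *m b + x = B *m x + b <-> X *m b = b /\ B *m x = x.
  move=> oB Bb cXB; split=> [e|[-> ->]]; last by rewrite addrC.
  have e0 : X *m b - b = - x - B *m (- x).
    by apply/eqP; rewrite mulmxN opprK subr_eq -addrA -e addrC addrK.
  have BXb : B *m (X *m b - b) = X *m b - b by rewrite mulmxBr mulmxA -cXB -mulmxA Bb.
  have [P [d [uP eB]]] := orth_spectral oB.
  (* This vector is fixed by [B] and lies in the image of [1 - B]; in eigencoordinates every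
     component is then 0. *)
  have z0 : X *m b - b = 0.
    apply: (can_inj (mulKmx (unitarymx_unit uP))); rewrite mulmx0.
    have ePB y : P *m (B *m y) = diag_mx d *m (P *m y).
      by rewrite mulmxA eB mul_udiag // mulmxA.
    have := congr1 (mulmx P) BXb; have := congr1 (mulmx P) e0.
    rewrite [P *m (- x - _)]mulmxBr !ePB.
    move: (P *m (X *m b - b)) (P *m (- x)) => z y /colP e2 /colP ez.
    apply/colP=> i; move: (ez i) (e2 i); rewrite !mul_diag_mx !mxE => hz hy.
    have [d1|dn] := eqVneq (d 0 i) 1; first by rewrite hy d1 mul1r subrr.
    move/eqP: hz; rewrite -subr_eq0 -{2}[z i 0]mul1r -mulrBl mulf_eq0 subr_eq0 (negPf dn).
    by move/eqP.
  have Xb : X *m b = b by apply/eqP; rewrite -subr_eq0 z0.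
  by split=> //; move: e; rewrite Xb [RHS]addrC => /addrI.
move=> h; split=> [] [/isEucP[X [x [oX rx ->]]] hc]; move: (hc);
  rewrite !euc_mul => /euc_inj[cX cx]; apply/centralizer_eucP; split=> //.
- exact/hX.
- have [Xa Ax] := (fixedP _ _ _ _ oA Aa cX).1 cx.
  by rewrite -scalemxAr Xa ((hx x).1 Ax) addrC.
- exact/hX.
- have A'a : A' *m (c *: a) = c *: a by rewrite -scalemxAr ((hx a).1 Aa).
  have [Xa Ax] := (fixedP _ _ _ _ oA' A'a cX).1 cx.
  move: Xa; rewrite -scalemxAr => /(scalerI c0) ->.
  by rewrite ((hx x).2 Ax) addrC.
Qed.

Lemma segre_conj_centralizers A a B b :
    orthogonal_mx A -> orthogonal_mx B -> a \is a realmx -> b \is a realmx ->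
  segre (euc A a) = segre (euc B b) -> conj_centralizers (euc A a) (euc B b).
Proof.
move=> oA oB ra rb /(segreP _ _ oA oB)[efix e1 em1 ep].
have [th [h1 h2 h3 h4 h5]] := segre_match oA oB e1 em1 ep.
have [K [A' [oK oA' eK hX hx]]] := orth_match oA oB h1 h2 (fun l _ => h3 l) h4 h5.
have [a0 [ra0 Aa0 ca fa]] := fixed_normal_form oA ra.
have [b0 [rb0 Bb0 cb fb]] := fixed_normal_form oB rb.
apply: (conj_centralizers_trans ca).
apply: conj_centralizers_trans (conj_centralizers_sym cb).
(* The centralizer does not see the scale [c], so it may be chosen to make the translation parts
   match. *)
suff [c [H [rc c0 oH eH Ha]]] : exists c H,
    [/\ c \is Num.real, c != 0, orthogonal_mx H, H *m A' = B *m H & H *m (c *: a0) = b0].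
  apply: (conj_centralizers_trans (g := euc A' (c *: a0))).
    exact/conj_centralizers_eq/centralizer_transport.
  apply/conj_centralizers_sym/(conj_centralizers_conj (k := euc H 0)).
    by apply: isEuc_euc => //; exact: mxOver0.
  by rewrite !euc_mul eH mulmx0 add0r Ha addr0.
have [a00|a0n] := eqVneq a0 0.
  have -> : b0 = 0 by apply/fb/efix/fa.
  by exists 1, K; rewrite a00 scaler0 mulmx0 oner_eq0; split.
have b0n : b0 != 0.
  by apply: contra_neq a0n => h; apply/fa/efix/fb.
pose na := sqrtC ((a0^T *m a0) 0 0); pose nb := sqrtC ((b0^T *m b0) 0 0).
have na0 : na != 0.
  by rewrite sqrtC_eq0; apply: contra_neq a0n; exact: dotmx_real_eq0.
have nb0 : nb != 0.
  by rewrite sqrtC_eq0; apply: contra_neq b0n; exact: dotmx_real_eq0.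
have ina : na \is Num.real by apply: ger0_real; rewrite sqrtC_ge0 dotmx_real_ge0.
have inb : nb \is Num.real by apply: ger0_real; rewrite sqrtC_ge0 dotmx_real_ge0.
(* This gives [c *: a0] the norm of [b0], as an orthogonal [H] requires. *)
pose c := nb / na; have rc : c \is Num.real by rewrite rpred_div.
have c0 : c != 0 by rewrite mulf_neq0 ?invr_eq0.
pose u := K *m (c *: a0).
have ru : u \is a realmx by rewrite mxOverM ?orth_real // mxOverZ.
have Bu : B *m u = u.
  by rewrite /u mulmxA -eK -mulmxA -scalemxAr ((hx a0).1 Aa0).
have euu : u^T *m u = b0^T *m b0.
  rewrite /u trmx_mul mulmxA -(mulmxA _ K^T) orth_mulVmx // mulmx1 [(c *: a0)^T]linearZ /=.
  rewrite -scalemxAl -scalemxAr scalerA.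
  rewrite [a0^T *m a0]mx11_scalar [b0^T *m b0]mx11_scalar scale_scalar_mx.
  congr (_%:M); rewrite -[X in _ * X]sqrtCK -[RHS]sqrtCK -/na -/nb /c.
  by field.
(* [K] already carries [A'] to [B]; composing with a map that commutes with [B] keeps this and moves
   [u] to [b0]. *)
have [H [oH cH Hu]] := fixed_vector_reflection oB ru rb0 Bu Bb0 euu.
exists c, (H *m K); split=> //; first exact: orth_mul.
  by rewrite -mulmxA eK !mulmxA cH.
by rewrite -mulmxA.
Qed.

End Euclidean.

(** * Eigenvectors of one linear part are eigenvectors of the other *)

Section SameCentralizer.
Variables (C : numClosedFieldType) (n : nat).
Implicit Types (A B K X : 'M[C]_n) (a b x : 'cV[C]_n) (v : 'rV[C]_n).

(** [A^T] inverts [A], so it acts on [v] by the inverse of [l], which is [l^*]. *)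
Lemma orth_eigen_tr A v l : orthogonal_mx A -> l * l^* = 1 ->
  v *m A = l *: v -> A *m v^T = l^* *: v^T.
Proof.
move=> oA ll e; apply: trmx_inj; rewrite trmx_mul trmxK linearZ /= trmxK.
have : v = l *: (v *m A^T) by rewrite scalemxAl -e -mulmxA orth_mulmxV // mulmx1.
by move/(congr1 ( *:%R l^*)); rewrite scalerA mulrC ll scale1r => ->.
Qed.

Lemma eigen_conj A v l : A \is a realmx ->
  v *m A = l *: v -> map_mx conjC v *m A = l^* *: map_mx conjC v.
Proof.
move=> rA /(congr1 (map_mx conjC)); rewrite map_mxM map_mxZ /=.
by rewrite (_ : map_mx conjC A = A) //; apply/realmx_conjP.
Qed.

Lemma dimker_gt0P A l : reflect (exists2 v : 'rV[C]_n, v != 0 & v *m A = l *: v) (0 < dimker A l)%N.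
Proof.
rewrite dimker_row lt0n mxrank_eq0; apply: (iffP idP) => [/rowV0Pn[v /eigenspaceP e nz]|[v nz e]].
  by exists v.
by apply/rowV0Pn; exists v => //; apply/eigenspaceP.
Qed.

Lemma eigenvector_norm A v l : orthogonal_mx A -> v != 0 -> v *m A = l *: v -> l * l^* = 1.
Proof. by move=> oA nz e; apply: (orth_eigen_norm oA); apply/dimker_gt0P; exists v. Qed.

Lemma row_fixP A v : orthogonal_mx A -> v *m A = v <-> A *m v^T = v^T.
Proof.
move=> oA; have c1 : (1 : C) * 1^* = 1 by rewrite conjC1 mulr1.
split=> h.
  by have := orth_eigen_tr oA c1 (etrans h (esym (scale1r v))); rewrite conjC1 scale1r.
by rewrite -{1}[v]trmxK -{1}h trmx_mul trmxK -mulmxA orth_mulVmx // mulmx1.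
Qed.

Lemma dotmx_row_neq0 v : v != 0 -> (v *m (map_mx conjC v)^T) 0 0 != 0.
Proof.
apply: contra_neq; rewrite mxE => h; apply/rowP=> j; rewrite [RHS]mxE.
have h0 k : true -> 0 <= v 0 k * (map_mx conjC v)^T k 0.
  by move=> _; rewrite !mxE mul_conjC_ge0.
move/psumr_eq0P: h => h; have /eqP := h h0 j isT.
by rewrite !mxE mul_conjC_eq0 => /eqP.
Qed.

(** By [centralizer_lift] each such [X] is the linear part of an element of the centralizer of
    [euc A a], for every real [a]. *)
Definition fixed_commutant_of A B := forall X, orthogonal_mx X -> X *m A = A *m X ->
  (forall x, A *m x = x -> X *m x = x) -> X *m B = B *m X.

Lemma eigen_dot_fix A v l x : v *m A = l *: v -> l != 1 -> A *m x = x -> v *m x = 0.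
Proof.
move=> e l1 h; have : v *m x = l *: (v *m x) by rewrite scalemxAl -e -mulmxA h.
move/eqP; rewrite -subr_eq0 -{1}[v *m x]scale1r -scalerBl scalemx_eq0 subr_eq0.
by rewrite eq_sym (negPf l1) => /eqP.
Qed.

(* B commutes with the map multiplying v by i, its conjugate by -i, and fixing their
   orthogonal complement. *)
Lemma nonreal_eigenvector A B v l : orthogonal_mx A -> fixed_commutant_of A B ->
  v *m A = l *: v -> l \isn't Num.real -> exists c, v *m B = c *: v.
Proof.
move=> oA hB ev lnr.
have [->|nz] := eqVneq v 0; first by exists 0; rewrite mul0mx scaler0.
have ll := eigenvector_norm oA nz ev.
have ll' : l^* * l^*^* = 1 by rewrite conjCK mulrC.
have l1 : l != 1 by apply: contraNneq lnr => ->; exact: real1.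
have l1' : l^* != 1 by rewrite (can2_eq conjCK conjCK) conjC1.
pose w := map_mx conjC v.
have ew : w *m A = l^* *: w by apply: eigen_conj => //; exact: orth_real.
pose N := (v *m w^T) 0 0; have N0 : N != 0 by exact: dotmx_row_neq0.
have vw : v *m w^T = N%:M by rewrite [LHS]mx11_scalar.
have wv : w *m v^T = N%:M.
  by rewrite -[LHS]trmxK trmx_mul trmxK vw tr_scalar_mx.
(* [A] preserves the bilinear product, which yields the factor [l * l]; it is not 1 because [l] is
   nonreal. *)
have vv : v *m v^T = 0.
  have : v *m v^T = (l * l) *: (v *m v^T).
    rewrite -{1}[v]mulmx1 -(orth_mulmxV oA) mulmxA ev -mulmxA -trmx_mul ev.
    by rewrite linearZ /= -scalemxAl -scalemxAr scalerA.
  move/eqP; rewrite -subr_eq0 -{1}[v *m _]scale1r -scalerBl scalemx_eq0 subr_eq0.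
  case/orP=> /eqP // h; case/negP: lnr.
  by move/esym/eqP: h; rewrite -expr2 sqrf_eq1 => /orP[] /eqP ->; rewrite ?realN real1.
have ww : w *m w^T = 0 by rewrite /w map_trmx -map_mxM vv map_mx0.
have NR : N^* = N.
  have := congr1 (map_mx conjC) vw; rewrite map_mxM -map_trmx map_mxCK wv.
  by move/matrixP/(_ 0 0); rewrite !mxE eqxx !mulr1n.
have NiR : (N^-1)^* = N^-1 by apply/CrealP; rewrite rpredV; apply/CrealP.
(* On rows these are the Hermitian orthogonal projections onto the lines of [v] and [w]. *)
pose p := N^-1 *: (w^T *m v); pose q := N^-1 *: (v^T *m w).
have pT : p^T = q by rewrite /p linearZ /= trmx_mul trmxK.
have qT : q^T = p by rewrite -pT trmxK.
have pC : map_mx conjC p = q.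
  by rewrite /p map_mxZ map_mxM /= NiR -map_trmx map_mxCK.
have qC : map_mx conjC q = p by rewrite -pC map_mxCK.
have outer (x y z t : 'rV[C]_n) : (N^-1 *: (x^T *m y)) *m (N^-1 *: (z^T *m t)) =
    (N^-1 * (N^-1 * (y *m z^T) 0 0)) *: (x^T *m t).
  rewrite -scalemxAl -scalemxAr !scalerA mulmxA -(mulmxA _ y) [y *m z^T]mx11_scalar.
  by rewrite mul_mx_scalar -scalemxAl scalerA !mxE eqxx mulr1n mulrA.
have pp : p *m p = p by rewrite outer -/N mulVf ?mulr1.
have qq : q *m q = q by rewrite -pT -trmx_mul pp.
have pq : p *m q = 0 by rewrite outer vv mxE !mulr0 scale0r.
have qp : q *m p = 0 by rewrite outer ww mxE !mulr0 scale0r.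
have vp : v *m p = v by rewrite -scalemxAr mulmxA vw mul_scalar_mx scalerA mulVf ?scale1r.
have vq : v *m q = 0 by rewrite -scalemxAr mulmxA vv mul0mx scaler0.
have pA : p *m A = l *: p by rewrite -scalemxAl -mulmxA ev -scalemxAr !scalerA mulrC.
have qA : q *m A = l^* *: q by rewrite -scalemxAl -mulmxA ew -scalemxAr !scalerA mulrC.
have Ap : A *m p = l *: p.
  by rewrite -scalemxAr mulmxA (orth_eigen_tr oA ll' ew) conjCK -scalemxAl !scalerA mulrC.
have Aq : A *m q = l^* *: q.
  by rewrite -scalemxAr mulmxA (orth_eigen_tr oA ll ev) -scalemxAl !scalerA mulrC.
have up u : u *m p = (N^-1 * (u *m w^T) 0 0) *: v.
  by rewrite -scalemxAr mulmxA [u *m w^T]mx11_scalar mul_scalar_mx scalerA !mxE eqxx mulr1n.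
have uq u : u *m q = (N^-1 * (u *m v^T) 0 0) *: w.
  by rewrite -scalemxAr mulmxA [u *m v^T]mx11_scalar mul_scalar_mx scalerA !mxE eqxx mulr1n.
have px x : A *m x = x -> p *m x = 0.
  by move=> h; rewrite -scalemxAl -mulmxA (eigen_dot_fix ev l1 h) mulmx0 scaler0.
have qx x : A *m x = x -> q *m x = 0.
  by move=> h; rewrite -scalemxAl -mulmxA (eigen_dot_fix ew l1' h) mulmx0 scaler0.
clearbody p q.
pose X := 1%:M + ('i - 1) *: p + (- 'i - 1) *: q.
have XT : X^T = 1%:M + (- 'i - 1) *: p + ('i - 1) *: q.
  by rewrite /X !linearD !linearZ /= trmx1 pT qT addrAC.
have rX : X \is a realmx.
  apply/realmx_conjP; rewrite /X !map_mxD !map_mxZ map_mx1 pC qC /= !rmorphB rmorphN /=.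
  by rewrite conjCi conjC1 opprK addrAC.
have i2 : 'i * 'i = -1 :> C by rewrite -expr2 sqrCi.
have oX : orthogonal_mx X.
  apply/orthP; split=> //; rewrite XT /X.
  rewrite !(mulmxDl, mulmxDr) !mul1mx !mulmx1 -!scalemxAl -!scalemxAr pp qq pq qp !scaler0 !scalerA.
  by apply/matrixP=> i j; rewrite !mxE; ring: i2.
have cX : X *m A = A *m X.
  by rewrite /X !mulmxDl !mulmxDr mul1mx mulmx1 -!scalemxAl -!scalemxAr pA Ap qA Aq.
have fX x : A *m x = x -> X *m x = x.
  by move=> h; rewrite /X !mulmxDl mul1mx -!scalemxAl px // qx // !scaler0 !addr0.
have cB := hB X oX cX fX.
pose u := v *m B.
have uX : u *m X = 'i *: u.
  rewrite /u -mulmxA -cB mulmxA /X !mulmxDr mulmx1 -!scalemxAr vp vq scaler0 addr0.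
  by rewrite scalerBl scale1r addrC subrK -scalemxAl.
(* The product with [v^T] reads off, up to scale, the component along [w], where [X] acts by [- 'i];
   comparing with [uX] kills it. *)
have uv : u *m v^T = 0.
  have := congr1 (fun z => (z *m v^T) 0 0) uX.
  rewrite /X !mulmxDr mulmx1 -!scalemxAr up uq !mulmxDl -!scalemxAl vv wv.
  rewrite [u *m v^T]mx11_scalar; move: ((u *m v^T) 0 0) (N^-1 * _) => s al.
  rewrite !mxE eqxx !mulr1n => es.
  have : 2 * ('i * s) = 0.
    transitivity ('i * s - (s + ('i - 1) * (al * 0) + (- 'i - 1) * (N^-1 * s * N))).
      by field.
    by rewrite es subrr.
  move/eqP; rewrite mulf_eq0 pnatr_eq0 /= mulf_eq0.
  rewrite (negPf (neq0Ci _)) => /eqP ->.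
  by apply/matrixP=> ? ?; rewrite !mxE mul0rn.
exists (N^-1 * (u *m w^T) 0 0); rewrite -up -/u.
have uq0 : u *m q = 0 by rewrite uq uv mxE mulr0 scale0r.
have h : u + ('i - 1) *: (u *m p) = 'i *: u.
  by rewrite -uX /X !mulmxDr mulmx1 -!scalemxAr uq0 scaler0 addr0.
have : ('i - 1) *: (u *m p) = ('i - 1) *: u.
  by rewrite [RHS]scalerBl scale1r -h addrAC subrr add0r.
move/scalerI => -> //; rewrite subr_eq0; apply/eqP => i1.
by move: i2; rewrite i1 mulr1 => /eqP; rewrite -subr_eq0 opprK paddr_eq0 ?oner_eq0.
Qed.

(** [B] commutes with the reflection [1%:M - 2 *: p], whose eigenspace for -1 is the line of [v]. *)
Lemma real_eigenvector A B v : orthogonal_mx A -> fixed_commutant_of A B ->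
  v \is a realmx -> v *m A = -1 *: v -> exists c, v *m B = c *: v.
Proof.
move=> oA hB rv ev.
have [->|nz] := eqVneq v 0; first by exists 0; rewrite mul0mx scaler0.
have vC := realmx_conjP _ rv.
pose N := (v *m v^T) 0 0.
have N0 : N != 0 by have := dotmx_row_neq0 nz; rewrite vC.
have vv : v *m v^T = N%:M by rewrite [LHS]mx11_scalar.
have NR : N^* = N.
  have := congr1 (map_mx conjC) vv; rewrite map_mxM -map_trmx vC vv.
  by move/matrixP/(_ 0 0); rewrite !mxE eqxx !mulr1n.
have n1 : -1 != 1 :> C by rewrite eq_sym -subr_eq0 opprK paddr_eq0 ?oner_eq0.
have n11 : (-1) * (-1)^* = 1 :> C by rewrite rmorphN /= conjC1 mulrNN mulr1.
have NiR : (N^-1)^* = N^-1 by apply/CrealP; rewrite rpredV; apply/CrealP.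
pose p := N^-1 *: (v^T *m v).
have pT : p^T = p by rewrite /p linearZ /= trmx_mul trmxK.
have vp : v *m p = v by rewrite -scalemxAr mulmxA vv mul_scalar_mx scalerA mulVf ?scale1r.
have pp : p *m p = p by rewrite {1}/p -scalemxAl -mulmxA vp.
have pC : map_mx conjC p = p.
  by rewrite /p map_mxZ map_mxM /= NiR -map_trmx vC.
have pA : p *m A = -1 *: p by rewrite -scalemxAl -mulmxA ev -scalemxAr !scalerA mulrC.
have Ap : A *m p = -1 *: p.
  rewrite -scalemxAr mulmxA (orth_eigen_tr oA n11 ev) -scalemxAl !scalerA mulrC.
  by rewrite rmorphN /= conjC1.
have up u : u *m p = (N^-1 * (u *m v^T) 0 0) *: v.
  by rewrite -scalemxAr mulmxA [u *m v^T]mx11_scalar mul_scalar_mx scalerA !mxE eqxx mulr1n.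
have px x : A *m x = x -> p *m x = 0.
  by move=> h; rewrite -scalemxAl -mulmxA (eigen_dot_fix ev n1 h) mulmx0 scaler0.
clearbody p.
pose X := 1%:M - 2 *: p.
have oX : orthogonal_mx X.
  have XT : X^T = X by rewrite /X linearB linearZ /= trmx1 pT.
  apply/orthP; split.
    by apply/realmx_conjP; rewrite /X map_mxB map_mxZ map_mx1 pC /= conjC_nat.
  rewrite XT /X mulmxBl mul1mx mulmxBr mulmx1 -scalemxAl -scalemxAr pp.
  by apply/matrixP=> i j; rewrite !mxE; ring.
have cX : X *m A = A *m X.
  by rewrite /X mulmxBl mulmxBr mul1mx mulmx1 -scalemxAl -scalemxAr pA Ap.
have fX x : A *m x = x -> X *m x = x.
  by move=> h; rewrite /X mulmxBl mul1mx -scalemxAl px // scaler0 subr0.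
have cB := hB X oX cX fX.
pose u := v *m B.
have uX : u *m X = - u.
  rewrite /u -mulmxA -cB mulmxA /X mulmxBr mulmx1 -scalemxAr vp.
  by rewrite scaler_nat mulr2n opprD addrA subrr add0r mulNmx.
exists (N^-1 * (u *m v^T) 0 0).
rewrite -up; move: uX; rewrite /X mulmxBr mulmx1 -scalemxAr -/u => h.
have two : (2 : C) != 0 by rewrite pnatr_eq0.
apply: (scalerI two); apply/eqP; rewrite eq_sym -subr_eq0 -opprB oppr_eq0.
by rewrite scaler_nat mulr2n -addrA h subrr.
Qed.

End SameCentralizer.

(** * Recovering the Segre symbol from the centralizer *)

Section Recover.
Variables (C : numClosedFieldType) (n : nat).
Implicit Types (A B K X : 'M[C]_n) (a b x : 'cV[C]_n) (v : 'rV[C]_n).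

(** The factors on [v0], [v] and [v0 + v] either agree or make [v] a multiple of [v0]. Closure under
    sums alone lets [S] consist of real vectors. *)
Lemma all_eigen_scalar (S : 'rV[C]_n -> Prop) B :
    (forall u v, S u -> S v -> S (u + v)) ->
    (forall v, S v -> exists c, v *m B = c *: v) ->
  exists c, forall v, S v -> v *m B = c *: v.
Proof.
move=> SD Sc; case: (excluded_middle_informative (exists2 v0, S v0 & v0 != 0)).
  case=> v0 S0 nz; have [c ec] := Sc _ S0; exists c => v Sv.
  have [d ed] := Sc _ Sv; have [e ee] := Sc _ (SD _ _ S0 Sv).
  move: ee; rewrite mulmxDl ec ed scalerDr => ee.
  have {}ee : (c - e) *: v0 = (e - d) *: v.
    rewrite !scalerBl; apply/eqP; rewrite subr_eq addrAC -subr_eq opprK; apply/eqP.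
    by rewrite ee addrC.
  have [edE|edn] := eqVneq e d.
    move: ee; rewrite edE subrr scale0r => /eqP; rewrite scaler_eq0 (negPf nz) orbF.
    by rewrite subr_eq0 => /eqP ->.
  have ev : v = ((e - d)^-1 * (c - e)) *: v0.
    by rewrite -scalerA ee scalerA mulVf ?scale1r // subr_eq0.
  by rewrite -ed ev -scalemxAl ec !scalerA mulrC.
move=> h; exists 0 => v Sv; have [->|nz] := eqVneq v 0; first by rewrite mul0mx scaler0.
by case: h; exists v.
Qed.

(** For nonreal [l] every eigenvector is covered. For -1 the scalar is found on real eigenvectors
    and extended through real and imaginary parts. *)
Lemma eigen_sub A B l : orthogonal_mx A -> fixed_commutant_of A B -> l != 1 ->
    (0 < dimker A l)%N ->
  exists c, (forall v, v *m A = l *: v -> v *m B = c *: v).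
Proof.
move=> oA hB l1 el.
have [lr|lnr] := boolP (l \is Num.real); last first.
  apply: (@all_eigen_scalar (fun v => v *m A = l *: v)) => [u v hu hv|v hv].
    by rewrite mulmxDl hu hv scalerDr.
  exact: nonreal_eigenvector hB hv lnr.
have /orP[/eqP h|/eqP {lr el l1}->] := orth_eigen_real oA el lr.
  by rewrite h eqxx in l1.
have [c hc] : exists c, forall v, v \is a realmx /\ v *m A = -1 *: v -> v *m B = c *: v.
  apply: (@all_eigen_scalar (fun v => v \is a realmx /\ v *m A = -1 *: v)).
    by move=> u v [ru hu] [rv hv]; rewrite realmxD // mulmxDl hu hv scalerDr.
  by move=> v [rv hv]; exact: real_eigenvector hB rv hv.
exists c => v hv.
have hvC : map_mx conjC v *m A = -1 *: map_mx conjC v.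
  have := eigen_conj (orth_real oA) hv; by rewrite rmorphN /= conjC1.
have h1 : (v + map_mx conjC v) *m B = c *: (v + map_mx conjC v).
  apply: hc; rewrite mulmxDl hv hvC scalerDr; split=> //.
  by apply/realmx_conjP; rewrite map_mxD map_mxCK addrC.
have h2 : ('i *: (v - map_mx conjC v)) *m B = c *: ('i *: (v - map_mx conjC v)).
  apply: hc; rewrite -scalemxAl mulmxBl hv hvC !scaleN1r -opprD scalerN scalerBr; split=> //.
  apply/realmx_conjP; rewrite map_mxB !map_mxZ map_mxCK /= conjCi.
  by rewrite !scaleNr opprK addrC.
have two : (2 : C) != 0 by rewrite pnatr_eq0.
apply: (scalerI two).
have -> : 2 *: (v *m B) = (v + map_mx conjC v) *m B - 'i *: (('i *: (v - map_mx conjC v)) *m B).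
  rewrite -scalemxAl scalerA -expr2 sqrCi scaleN1r opprK -mulmxDl addrACA subrr addr0.
  by rewrite -mulr2n -scaler_nat scalemxAl.
have i2 : 'i * 'i = -1 :> C by rewrite -expr2 sqrCi.
by rewrite h1 h2; apply/matrixP=> i j; rewrite !mxE; ring: i2.
Qed.

Lemma eigen_unique B v c d : v != 0 -> v *m B = c *: v -> v *m B = d *: v -> c = d.
Proof.
move=> nz -> /eqP; rewrite -subr_eq0 -scalerBl scaler_eq0 (negPf nz) orbF subr_eq0.
by move/eqP.
Qed.

Definition same_eigenspace A l B m := forall v, v *m A = l *: v <-> v *m B = m *: v.

Lemma same_eigenspace_sym A l B m : same_eigenspace A l B m -> same_eigenspace B m A l.
Proof. by move=> h v; split=> /h. Qed.

Lemma same_eigenspace_dim A l B m : same_eigenspace A l B m -> dimker A l = dimker B m.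
Proof.
move=> h; rewrite !dimker_row; apply/eqP; rewrite eqn_leq; apply/andP.
by split; apply/mxrankS/rV_subP=> v /eigenspaceP/h/eigenspaceP.
Qed.

Lemma same_eigenspace_conj A l B m : A \is a realmx -> B \is a realmx ->
  same_eigenspace A l B m -> same_eigenspace A l^* B m^*.
Proof.
move=> rA rB h v; split=> /eigen_conj; rewrite conjCK => e.
  by have /(eigen_conj rB) := (h _).1 (e rA); rewrite map_mxCK.
by have /(eigen_conj rA) := (h _).2 (e rB); rewrite map_mxCK.
Qed.

(** [eigen_sub] is used from [A] to [B] and back; the common eigenvector [v] shows that the scalar
    after the return is [l]. *)
Lemma same_eigenspace_exists A B l : orthogonal_mx A -> orthogonal_mx B ->
    fixed_commutant_of A B -> fixed_commutant_of B A ->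
    same_eigenspace A 1 B 1 -> (0 < dimker A l)%N ->
  exists m, same_eigenspace A l B m.
Proof.
move=> oA oB hAB hBA h1 el; have [->|l1] := eqVneq l 1; first by exists 1.
have [m hm] := eigen_sub oA hAB l1 el; have /dimker_gt0P[v nz ev] := el.
have em : (0 < dimker B m)%N by apply/dimker_gt0P; exists v; rewrite ?hm.
have m1 : m != 1.
  apply: contraNneq l1 => e1; have := hm _ ev; rewrite e1 => /h1 e.
  by rewrite (eigen_unique nz ev e).
have [l' hl'] := eigen_sub oB hBA m1 em.
have ll' : l' = l by apply: (eigen_unique nz (hl' _ (hm _ ev)) ev).
by exists m => u; split=> [/hm //|/hl']; rewrite ll'.
Qed.

(** For real [l] the eigenspace is stable under conjugation, so [B] acts on it by [m] and by [m^*]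
    alike. *)
Lemma same_eigenspace_real A l B m : A \is a realmx -> B \is a realmx ->
  (0 < dimker A l)%N -> same_eigenspace A l B m -> l \is Num.real -> m \is Num.real.
Proof.
move=> rA rB /dimker_gt0P[v nz ev] h /CrealP rl; apply/CrealP.
apply: (eigen_unique nz); last exact/h.
by have := (same_eigenspace_conj rA rB h v).1; rewrite rl; apply.
Qed.

(** The matching [m] is real, so 1 or -1; the value 1 would make [A] fix an eigenvector for -1. *)
Lemma dimkerN1_le A B : orthogonal_mx A -> orthogonal_mx B ->
    fixed_commutant_of A B -> fixed_commutant_of B A -> same_eigenspace A 1 B 1 ->
  (0 < dimker A (-1))%N -> dimker A (-1) = dimker B (-1).
Proof.
move=> oA oB hAB hBA h1 el.
have [m hm] := same_eigenspace_exists oA oB hAB hBA h1 el.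
have rm : m \is Num.real.
  by apply: same_eigenspace_real hm _; rewrite ?orth_real // realN real1.
have em : (0 < dimker B m)%N by rewrite -(same_eigenspace_dim hm).
have /orP[/eqP m1|/eqP m1] := orth_eigen_real oB em rm; last first.
  by rewrite m1 in hm; exact: same_eigenspace_dim.
have /dimker_gt0P[v nz ev] := el.
have e2 : v *m A = 1 *: v by apply/h1; rewrite -m1; apply/hm.
have /eqP := eigen_unique nz ev e2.
by rewrite eq_sym -subr_eq0 opprK paddr_eq0 ?oner_eq0.
Qed.

(** [cpairs] lists upper half-plane eigenvalues only, while the eigenvalue of [B] matching [l] may
    be in the lower half-plane. *)
Definition paired A B l m := same_eigenspace A l B m \/ same_eigenspace A l B m^*.

Lemma paired_sym A B l m : A \is a realmx -> B \is a realmx -> paired A B l m -> paired B A m l.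
Proof.
move=> rA rB [h|h]; [left|right]; first exact: same_eigenspace_sym.
by apply: same_eigenspace_sym; rewrite -[m]conjCK; exact: same_eigenspace_conj.
Qed.

Lemma paired_exists A B l : orthogonal_mx A -> orthogonal_mx B ->
    fixed_commutant_of A B -> fixed_commutant_of B A -> same_eigenspace A 1 B 1 ->
  l \in cpairs A -> exists2 m, m \in cpairs B & paired A B l m.
Proof.
move=> oA oB hAB hBA h1; rewrite (cpairsP oA).2 => /andP[l0 el].
have [m hm] := same_eigenspace_exists oA oB hAB hBA h1 el.
have em : (0 < dimker B m)%N by rewrite -(same_eigenspace_dim hm).
have mnr : 'Im m != 0.
  apply: contraTneq l0 => /Creal_ImP rm; rewrite -real_leNgt ?real0 ?Creal_Im //.
  have /Creal_ImP -> // : l \is Num.real.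
  by apply: (same_eigenspace_real _ _ em (same_eigenspace_sym hm) rm); exact: orth_real.
have := real_ltgt0P (Creal_Im m); case=> h; last by rewrite h eqxx in mnr.
  by exists m; [rewrite (cpairsP oB).2 h|left].
exists m^*; last by right; rewrite conjCK.
by rewrite (cpairsP oB).2 Im_conj oppr_gt0 h dimker_conj ?orth_real.
Qed.

Lemma paired_fun A B l m m' : orthogonal_mx A -> orthogonal_mx B ->
  l \in cpairs A -> m \in cpairs B -> m' \in cpairs B ->
  paired A B l m -> paired A B l m' -> m = m'.
Proof.
move=> oA oB; rewrite (cpairsP oA).2 !(cpairsP oB).2.
move=> /andP[_ /dimker_gt0P[v nz ev]] /andP[m0 _] /andP[m0' _].
have no (c d : C) : 0 < 'Im c -> 0 < 'Im d -> c = d^* -> c = d.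
  by move=> + d0 e; rewrite e Im_conj oppr_gt0 => /lt_gtF; rewrite d0.
case=> /(_ v)[/(_ ev) e _]; case=> /(_ v)[/(_ ev) e' _]; have := eigen_unique nz e e'.
- by [].
- exact: no.
- by move/esym/(no _ _ m0' m0).
- exact: (can_inj conjCK).
Qed.

Lemma perm_cpairs A B : orthogonal_mx A -> orthogonal_mx B ->
    fixed_commutant_of A B -> fixed_commutant_of B A -> same_eigenspace A 1 B 1 ->
  perm_eq [seq dimker A l | l <- cpairs A] [seq dimker B l | l <- cpairs B].
Proof.
move=> oA oB hAB hBA h1; have rA := orth_real oA; have rB := orth_real oB.
apply: (@perm_map_rel _ _ _ (0 : C) (paired A B)).
- exact: (cpairsP oA).1.
- exact: (cpairsP oB).1.
- by move=> l; exact: paired_exists.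
- move=> m hm.
  have [l hl /(paired_sym rB rA)] := paired_exists oB oA hBA hAB (same_eigenspace_sym h1) hm.
  by exists l.
- by move=> l m m'; exact: paired_fun.
- by move=> l l' m hl hl' hm /(paired_sym rA rB) h /(paired_sym rA rB); exact: paired_fun h.
- move=> l m [/same_eigenspace_dim //|/same_eigenspace_dim ->].
  exact: dimker_conj.
Qed.

(** Seen from the point [- t], the translation part is fixed by [A], hence by [X]; the witness is
    [X] acting about that point. *)
Lemma centralizer_lift A a X : orthogonal_mx A -> a \is a realmx -> orthogonal_mx X ->
    X *m A = A *m X -> (forall x, A *m x = x -> X *m x = x) ->
  exists x, centralizer (euc A a) (euc X x).
Proof.
move=> oA ra oX cX fX; have [t [rt et]] := fixed_part oA ra.
exists (X *m t - t); apply/centralizer_eucP; split=> //.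
  by rewrite realmxB // mxOverM ?orth_real.
have h := fX _ et; rewrite mulmxBr mulmxDr mulmxA cX in h.
have {}h : X *m a + X *m t = a + t - A *m t + A *m X *m t by rewrite -h subrK.
rewrite addrA h mulmxBr mulmxA; move: (A *m X *m t) (A *m t) => y z.
by apply/matrixP=> i j; rewrite !mxE; ring.
Qed.

(** The point reflection in a fixed point commutes with the isometry. Conversely commutation says
    [2 *: a = x - A *m x], so half of [x] is a fixed point. *)
Lemma has_fixpoint_reflection A a : orthogonal_mx A -> a \is a realmx ->
  has_fixpoint A a <-> exists x, centralizer (euc A a) (euc (- 1%:M) x).
Proof.
move=> oA ra.
have o1 : orthogonal_mx (- 1%:M : 'M[C]_n).
  apply/orthP; split; first exact/realmxN/realmx1.
  by rewrite linearN /= trmx1 mulNmx mulmxN mul1mx opprK.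
have two : (2 : C) != 0 by rewrite pnatr_eq0.
split=> [[y ey]|[x /centralizer_eucP[_ _ _]]]; last first.
  rewrite mulNmx mul1mx => h; exists (2^-1 *: x).
  have {}h : 2 *: a = x - A *m x.
    rewrite scaler_nat mulr2n; apply/eqP; rewrite -subr_eq0; apply/eqP.
    have -> : a + a - (x - A *m x) = (A *m x + a) - (- a + x).
      by move: (A *m x) => z; apply/matrixP=> i j; rewrite !mxE; ring.
    by rewrite h subrr.
  by rewrite -scalemxAr -scalerBr -h scalerA mulVf ?scale1r.
(* Twice the real part of [y], which is again a fixed point. *)
exists (y + map_mx conjC y); apply/centralizer_eucP; split=> //.
- by apply/realmx_conjP; rewrite map_mxD map_mxCK addrC.
- by rewrite mulNmx mulmxN mul1mx mulmx1.
have eC : a = map_mx conjC y - A *m map_mx conjC y.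
  have := congr1 (map_mx conjC) ey.
  by rewrite map_mxB map_mxM (realmx_conjP _ ra) (realmx_conjP _ (orth_real oA)).
rewrite mulNmx mul1mx mulmxDr {1}ey eC.
move: (A *m y) (A *m _) => z z'.
by apply/matrixP=> i j; rewrite !mxE; ring.
Qed.

Lemma same_centralizer_commutant A a B b : orthogonal_mx A -> a \is a realmx ->
    (forall h, centralizer (euc A a) h -> centralizer (euc B b) h) ->
  fixed_commutant_of A B.
Proof.
move=> oA ra hZ X oX cX fX; have [x /hZ] := centralizer_lift oA ra oX cX fX.
by case/centralizer_eucP.
Qed.

(** Translation by a real vector commutes with an isometry exactly when the linear part fixes the
    vector; complex vectors split into real and imaginary parts. *)
Lemma same_centralizer_fixed A a B b : orthogonal_mx A -> orthogonal_mx B ->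
    (forall h, centralizer (euc A a) h -> centralizer (euc B b) h) ->
  forall v, v *m A = 1 *: v -> v *m B = 1 *: v.
Proof.
move=> oA oB hZ.
have rfix x : x \is a realmx -> A *m x = x -> B *m x = x.
  move=> rx Ax; have : centralizer (euc A a) (euc 1%:M x).
    apply/centralizer_eucP; split=> //; rewrite ?mul1mx ?mulmx1 //; first exact: orth1.
    by rewrite Ax addrC.
  by move/hZ/centralizer_eucP=> [_ _ _]; rewrite mul1mx [RHS]addrC => /addrI.
have fix_ x : A *m x = x -> B *m x = x.
  move=> Ax; have AxC : A *m map_mx conjC x = map_mx conjC x.
    by rewrite -{2}Ax map_mxM (realmx_conjP _ (orth_real oA)).
  have h1 : B *m (x + map_mx conjC x) = x + map_mx conjC x.
    apply: rfix; last by rewrite mulmxDr Ax AxC.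
    by apply/realmx_conjP; rewrite map_mxD map_mxCK addrC.
  have h2 : B *m ('i *: (x - map_mx conjC x)) = 'i *: (x - map_mx conjC x).
    apply: rfix; last by rewrite -scalemxAr mulmxBr Ax AxC.
    apply/realmx_conjP; rewrite map_mxZ map_mxB map_mxCK /= conjCi scaleNr -scalerN opprB.
    by [].
  have {}h2 : B *m (x - map_mx conjC x) = x - map_mx conjC x.
    by apply: (scalerI (neq0Ci C)); rewrite scalemxAr.
  have two : (2 : C) != 0 by rewrite pnatr_eq0.
  have e : 2 *: x = (x + map_mx conjC x) + (x - map_mx conjC x).
    by apply/matrixP=> i j; rewrite !mxE; ring.
  by apply: (scalerI two); rewrite scalemxAr e mulmxDr h1 h2.
by move=> v; rewrite scale1r => /(row_fixP _ oA)/fix_/(row_fixP _ oB).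
Qed.

Lemma same_centralizer_segre A a B b : orthogonal_mx A -> orthogonal_mx B ->
    a \is a realmx -> b \is a realmx ->
    (forall h, centralizer (euc A a) h <-> centralizer (euc B b) h) ->
  segre (euc A a) = segre (euc B b).
Proof.
move=> oA oB ra rb hZ.
have hAB := fun h => (hZ h).1; have hBA := fun h => (hZ h).2.
have cAB := same_centralizer_commutant oA ra hAB.
have cBA := same_centralizer_commutant oB rb hBA.
have h1 : same_eigenspace A 1 B 1.
  by move=> v; split; [exact: same_centralizer_fixed hAB _|exact: same_centralizer_fixed hBA _].
apply/segreP => //; split.
- rewrite !has_fixpoint_reflection //.
  by split=> [] [x /hZ h]; exists x.
- exact: same_eigenspace_dim.
- have [eA|] := posnP (dimker A (-1)); last exact: dimkerN1_le.
  have [->//|eB] := posnP (dimker B (-1)).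
  by apply/esym/dimkerN1_le => //; exact: same_eigenspace_sym.
- exact: perm_cpairs.
Qed.

Lemma segre_conj A a A' a' (k : 'M[C]_(n + 1)) : orthogonal_mx A -> orthogonal_mx A' ->
    isEuc k -> euc A a *m k = k *m euc A' a' ->
  segre (euc A a) = segre (euc A' a').
Proof.
move=> oA oA' ek e.
have ed m : dimker (euc A a) m = dimker (euc A' a') m.
  by apply/esym/(dimker_similar _ (isEuc_unit ek)); rewrite e.
have eA m : dimker A m = dimker A' m.
  have [K [c [oK _ ekK]]] := (isEucP k).1 ek.
  apply/esym/(dimker_similar _ (orth_unit oK)).
  by move: e; rewrite ekK !euc_mul => /euc_inj[].
apply/segreP => //; split=> //; first by rewrite -!dimker_euc ed eA.
rewrite (eq_map eA); apply/perm_map/uniq_perm.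
- exact: (cpairsP oA).1.
- exact: (cpairsP oA').1.
- by move=> l; rewrite (cpairsP oA).2 (cpairsP oA').2 eA.
Qed.

End Recover.

Theorem mainTheorem2 (C : numClosedFieldType) (n : nat) (hn : (1 <= n)%N)
    (f g : 'M[C]_(n + 1)) :
  isEuc f -> isEuc g ->
  (segre f = segre g <-> conj_centralizers f g).
Proof.
move=> ef eg; have [A [a [oA ra fE]]] := (isEucP f).1 ef.
have [B [b [oB rb gE]]] := (isEucP g).1 eg.
split; first by rewrite fE gE; exact: segre_conj_centralizers.
move=> [k [ek hk]]; have uk := isEuc_unit ek.
(* [f'] has the symbol of [f], and its centralizer equals that of [g] instead of being merely
   conjugate to it. *)
pose f' := invmx k *m f *m k.
have ef' : isEuc f' by apply: isEuc_mul => //; apply: isEuc_mul => //; exact: isEuc_inv.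
have fk : f *m k = k *m f' by rewrite /f' !mulmxA mulmxV // mul1mx.
have [A' [a' [oA' ra' f'E]]] := (isEucP f').1 ef'.
have -> : segre f = segre f' by rewrite fE f'E; apply: segre_conj ek _ => //; rewrite -fE -f'E.
rewrite f'E gE; apply: same_centralizer_segre => // h; rewrite -f'E -gE.
have -> : h = invmx k *m (k *m h *m invmx k) *m k by rewrite !mulmxA mulVmx // mul1mx mulmxKV.
by rewrite -hk (centralizer_conj ek fk).
Qed.
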